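(* Let $S$ be a Dirac bundle over a compact Riemannian manifold $M$, with Dirac operator $D$ and Weitzenböck curvature operator $\mathcal{R}$. If $\mathcal{R}$ is positive semi-definite, then every section $\sigma\in\Gamma(S)$ in the kernel of $D$ is parallel ($\nabla\sigma=0$) and satisfies $\langle\mathcal{R}\sigma,\sigma\rangle=0$. Furthermore, if $\mathcal{R}$ is also positive definite at some point of $M$, then $D$ has trivial kernel.
   Context: Manifolds are smooth without boundary. $M$ is an $n$-dimensional Riemannian manifold and $\mathrm{C}\ell(M)$ is its Clifford bundle (convention $X\cdot X=-|X|^2$ for $X\in T_pM$), with the naturally induced metric and connection. A Dirac bundle over $M$ is a (finite-rank real) vector bundle $S\to M$ that is a left $\mathrm{C}\ell(M)$-module, together with a euclidean fibre metric $\langle\cdot,\cdot\rangle$ and a metric connection $\nabla$ such that: (i) $\langle X\cdot\sigma,\tau\rangle+\langle\sigma,X\cdot\tau\rangle=0$ for all $X\in T_pM$, $\sigma,\tau\in S_p$; (ii) $\nabla(a\cdot\sigma)=(\nabla a)\cdot\sigma+a\cdot\nabla\sigma$ for all $a\in\Gamma(\mathrm{C}\ell(M))$, $\sigma\in\Gamma(S)$. $\Gamma(S)$ denotes smooth sections. In a local orthonormal frame $e_1,\dots,e_n$ of $TM$, the Dirac operator is $D\sigma=\sum_{i}e_i\cdot\nabla_{e_i}\sigma$ and the Weitzenböck curvature operator is the bundle endomorphism $\mathcal{R}\sigma=\sum_{i<j}e_i\cdot e_j\cdot R(e_i,e_j)\sigma$, where $R(X,Y)=\nabla_X\nabla_Y-\nabla_Y\nabla_X-\nabla_{[X,Y]}$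 is the curvature of $\nabla$ on $S$. $\mathcal{R}$ is positive semi-definite (resp. definite) at $p$ if $\langle\mathcal{R}v,v\rangle\ge 0$ for all $v\in S_p$ (resp. $>0$ for all $0\ne v\in S_p$); it is positive semi-definite if it is so at every point of $M$.
   Formalization: For the ''Furthermore'' part, M is also assumed connected; without this the claim fails (e.g. a round sphere, with positive definite R, together with a disjoint flat torus carrying a nonzero parallel section). The first part holds for every compact M. *)

(* Defs.v *)
From HB Require Import structures.
From mathcomp Require Import all_boot all_order all_algebra.
From mathcomp Require Import all_classical all_reals all_analysis.
From mathcomp Require Import ring.
Set Implicit Arguments. Unset Strict Implicit. Unset Printing Implicit Defensive.
Import Order.TTheory GRing.Theory Num.Theory numFieldNormedType.Exports.
Local Open Scope classical_set_scope. Local Open Scope ring_scope.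

Lemma near_eq_differentiable (R : realType) (V W : normedModType R)
    (f g : V -> W) (x : V) :
  {near x, f =1 g} -> differentiable f x -> differentiable g x.
Proof.
move=> fg /diff_locallyP [cf Ef].
have E : g \o shift x = cst (g x) + 'd f x +o_ 0 id.
  apply/eqaddoP => e e0; have /eqaddoP/(_ e e0) := Ef.
  have fg' : \forall h \near 0, f (h + x) = g (h + x).
    by have := fg; rewrite (near_shift 0)/=; apply: filterS => y; rewrite subr0.
  apply: filterS2 fg' => h fgh; rewrite /= !fctE /= fgh.
  by rewrite (nbhs_singleton fg).
apply/diff_locallyP; rewrite (_ : 'd g x = 'd f x :> (V -> W)) //.
exact: diff_unique.
Qed.

Section EuclideanSmooth.
Context {R : realType} {n : nat}.
Implicit Types (f g : 'rV[R]_n -> R) (x y v : 'rV[R]_n).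

(* Iterated directional derivatives; the head of the list is taken first. *)
Fixpoint iter_derive (vs : seq 'rV[R]_n) f : 'rV[R]_n -> R :=
  if vs is v :: vs' then iter_derive vs' (fun x => 'D_v f x) else f.

(* [f] is C^oo on some neighbourhood of [x]. *)
Definition smooth_at x f :=
  \forall y \near x, forall vs, differentiable (iter_derive vs f) y.

(* Auxiliary: the germs at [x] obtained from smooth ones by sums and products. *)
Inductive smooth_alg x : ('rV[R]_n -> R) -> Prop :=
| SAbase f of smooth_at x f : smooth_alg x f
| SAadd f g of smooth_alg x f & smooth_alg x g : smooth_alg x (f + g)
| SAmul f g of smooth_alg x f & smooth_alg x g : smooth_alg x (f * g)
| SAeq f g of smooth_alg x f & {near x, f =1 g} : smooth_alg x g.

Lemma smooth_alg_near x f : smooth_alg x f -> \forall y \near x, smooth_alg y f.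
Proof.
elim=> {f} [f|f g _ + _|f g _ + _|f g _ fx /near_join fg].
- by move=> /near_join; apply: filterS => y; exact: SAbase.
- by apply: filterS2 => y; exact: SAadd.
- by apply: filterS2 => y; exact: SAmul.
- by apply: filterS2 fx fg => y; exact: SAeq.
Qed.

Lemma smooth_alg_differentiable x f : smooth_alg x f -> differentiable f x.
Proof.
elim=> {f} [f /nbhs_singleton /(_ [::]) //|f g _ + _|f g _ + _|f g _ fx fg].
- exact: differentiableD.
- exact: differentiableM.
- exact: near_eq_differentiable fg fx.
Qed.

Lemma smooth_alg_derive x f v :
  smooth_alg x f -> smooth_alg x (fun y => 'D_v f y).
Proof.
elim=> {f} [f fx|f g fx dfx gx dgx|f g fx dfx gx dgx|f g fx dfx fg].
- by apply: SAbase; apply: filterS fx => y fy vs; exact: (fy (v :: vs)).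
- apply: SAeq (SAadd dfx dgx) _.
  have := smooth_alg_near fx; have := smooth_alg_near gx.
  apply: filterS2 => y gy fy; rewrite deriveD //;
    exact/diff_derivable/smooth_alg_differentiable.
- apply: SAeq (SAadd (SAmul fx dgx) (SAmul gx dfx)) _.
  have := smooth_alg_near fx; have := smooth_alg_near gx.
  apply: filterS2 => y gy fy; rewrite deriveM //;
    exact/diff_derivable/smooth_alg_differentiable.
- apply: SAeq dfx _; have := near_join fg.
  by apply: filterS => y fgy; exact: near_eq_derive.
Qed.

Lemma smooth_algP x f : smooth_alg x f -> smooth_at x f.
Proof.
move=> /smooth_alg_near; apply: filterS => y fy vs.
elim: vs f fy => [|v vs IH] f fy /=; first exact: smooth_alg_differentiable.
exact/IH/smooth_alg_derive.
Qed.

Lemma smooth_at_cst x (a : R) : smooth_at x (cst a).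
Proof.
near=> y => vs; elim: vs a => [|v vs IH] a /=; first exact: differentiable_cst.
rewrite (_ : (fun x => 'D_v (cst a) x) = cst 0) //.
by apply/funext => z; rewrite derive_cst.
Unshelve. all: by end_near. Qed.

Lemma smooth_atD x f g : smooth_at x f -> smooth_at x g -> smooth_at x (f + g).
Proof. by move=> fx gx; apply/smooth_algP/SAadd; exact: SAbase. Qed.

Lemma smooth_atM x f g : smooth_at x f -> smooth_at x g -> smooth_at x (f * g).
Proof. by move=> fx gx; apply/smooth_algP/SAmul; exact: SAbase. Qed.

End EuclideanSmooth.

(* [chart_fun] and [chart_inv] are only meaningful on [chart_dom] and its image. *)
Record chart (R : realType) (n : nat) (M : topologicalType) := Chart {
  chart_dom : set M;
  chart_fun :> M -> 'rV[R]_n;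
  chart_inv : 'rV[R]_n -> M;
  chart_dom_open : open chart_dom;
  chart_img_open : open (chart_fun @` chart_dom);
  chart_fun_continuous : {in chart_dom, continuous chart_fun};
  chart_inv_continuous : {in chart_fun @` chart_dom, continuous chart_inv};
  chart_funK : {in chart_dom, cancel chart_fun chart_inv} }.

(* The atlas need not be maximal. *)
Record manifold (R : realType) (n : nat) := Manifold {
  mf_space :> topologicalType;
  mf_hausdorff : hausdorff_space mf_space;
  mf_second_countable : @second_countable mf_space;
  atlas : set (chart R n mf_space);
  atlas_cover : forall p, exists2 c, atlas c & chart_dom c p;
  atlas_compat : forall c d p, atlas c -> atlas d ->
    chart_dom c p -> chart_dom d p ->
    forall j, smooth_at (c p) (fun x => d (chart_inv c x) ord0 j) }.

Arguments atlas {R n} m _.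

Section SmoothFunctions.
Context {R : realType} {n : nat}.
Variable M : manifold R n.
Implicit Types (f g : M -> R) (p : M).

Definition msmooth_at p f :=
  forall c, atlas M c -> chart_dom c p -> smooth_at (c p) (f \o chart_inv c).

Lemma msmooth_at_cst p (a : R) : msmooth_at p (cst a).
Proof. by move=> c _ _; exact: smooth_at_cst. Qed.

Lemma msmooth_atD p f g :
  msmooth_at p f -> msmooth_at p g -> msmooth_at p (f + g).
Proof. by move=> fp gp c Mc cp; apply: smooth_atD; [exact: fp|exact: gp]. Qed.

Lemma msmooth_atM p f g :
  msmooth_at p f -> msmooth_at p g -> msmooth_at p (f * g).
Proof. by move=> fp gp c Mc cp; apply: smooth_atM; [exact: fp|exact: gp]. Qed.

Definition smooth : {pred M -> R} := fun f => `[< forall p, msmooth_at p f >].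

Lemma smooth_subring_closed : subring_closed smooth.
Proof.
split=> [|f g /asboolP fs /asboolP gs|f g /asboolP fs /asboolP gs].
- by apply/asboolP => p; exact: msmooth_at_cst.
- apply/asboolP => p; apply: msmooth_atD => //.
  rewrite -mulN1r; apply: msmooth_atM => //; exact: (@msmooth_at_cst _ (-1)).
- by apply/asboolP => p; exact: msmooth_atM.
Qed.

Lemma smooth_scaler_closed : scaler_closed smooth.
Proof.
move=> a f /asboolP fs; apply/asboolP => p.
by apply: (@msmooth_atM _ (cst a)) => //; exact: msmooth_at_cst.
Qed.

HB.instance Definition _ :=
  GRing.isSubringClosed.Build (M -> R) smooth smooth_subring_closed.
HB.instance Definition _ :=
  GRing.isScaleClosed.Build R (M -> R) smooth smooth_scaler_closed.

Record smooth_fun := SmoothFun {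
  smooth_fun_val :> M -> R;
  smooth_funP : smooth_fun_val \in smooth }.

HB.instance Definition _ := [isSub for smooth_fun_val].
HB.instance Definition _ := [Choice of smooth_fun by <:].
HB.instance Definition _ :=
  GRing.SubChoice_isSubComPzRing.Build _ _ smooth_fun (subringClosedP _).
HB.instance Definition _ := [SubZmodule_isSubLmodule of smooth_fun by <:].

Lemma smooth_fun_at (f : smooth_fun) p : msmooth_at p f.
Proof. by have /asboolP := smooth_funP f. Qed.

End SmoothFunctions.

Section TangentSpace.
Context {R : realType} {n : nat} {M : manifold R n}.
Variable p : M.

(* Tangent vectors at [p] are the derivations at [p] of the algebra C^oo(M). *)
Definition derivation : {pred smooth_fun M -> R} := fun v =>
  `[< (forall a (f g : smooth_fun M), v (a *: f + g) = a * v f + v g) /\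
      (forall f g : smooth_fun M, v (f * g) = f p * v g + g p * v f) >].

Lemma derivation_submod_closed : submod_closed derivation.
Proof.
pose F := smooth_fun M -> R.
have F0 g : (0 : F) g = 0 by [].
have FE a (u v : F) g : (a *: u + v) g = a * u g + v g by [].
split=> [|a u v /asboolP[ul up] /asboolP[vl vp]]; apply/asboolP; split=> *.
- by rewrite !F0 mulr0 addr0.
- by rewrite !F0 !mulr0 addr0.
- by rewrite !FE ul vl; ring.
- by rewrite !FE up vp; ring.
Qed.

HB.instance Definition _ := GRing.isSubmodClosed.Build R (smooth_fun M -> R)
  derivation derivation_submod_closed.

Record tangent := Tangent {
  tangent_val :> smooth_fun M -> R;
  tangentP : tangent_val \in derivation }.

HB.instance Definition _ := [isSub for tangent_val].
HB.instance Definition _ := [Choice of tangent by <:].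
HB.instance Definition _ := [SubChoice_isSubLmodule of tangent by <:].

End TangentSpace.

(* A family of real vector spaces over [M] with its C^oo(M)-module of smooth
   sections.  It is the common interface of the tangent bundle, the Clifford
   bundle and general vector bundles, through which metrics and connections
   are defined. *)
Record bundle (R : realType) (n : nat) (M : manifold R n) := Bundle {
  fibre :> M -> lmodType R;
  smooth_section : set (forall p, fibre p);
  smooth_section0 : smooth_section (fun=> 0);
  smooth_sectionP : forall (f : smooth_fun M) s t,
    smooth_section s -> smooth_section t ->
    smooth_section (fun p => f p *: s p + t p) }.

Section Sections.
Context {R : realType} {n : nat} {M : manifold R n}.
Variable E : bundle M.

Record section := MkSection {
  section_val :> forall p, E p;
  sectionP : smooth_section section_val }.

HB.instance Definition _ := gen_eqMixin section.
HB.instance Definition _ := gen_choiceMixin section.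

Lemma section_eq (s t : section) : (forall p, s p = t p) -> s = t.
Proof.
case: s t => [s sP] [t tP] /= st.
have {}st : s = t by apply: functional_extensionality_dep.
by rewrite st in sP *; congr MkSection; exact: Prop_irrelevance.
Qed.

Definition section_zero := MkSection (smooth_section0 E).

Lemma section_add_subproof (s t : section) :
  smooth_section (fun p => s p + t p).
Proof.
have := smooth_sectionP 1 (sectionP s) (sectionP t).
by congr smooth_section; apply: functional_extensionality_dep => p; rewrite scale1r.
Qed.

Definition section_add s t := MkSection (section_add_subproof s t).

Lemma section_scale_subproof (f : smooth_fun M) (s : section) :
  smooth_section (fun p => f p *: s p).
Proof.
have := smooth_sectionP f (sectionP s) (smooth_section0 E).
by congr smooth_section; apply: functional_extensionality_dep => p; rewrite addr0.
Qed.

Definition section_scale f s := MkSection (section_scale_subproof f s).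

Definition section_opp s := section_scale (-1) s.

Lemma section_addA : associative section_add.
Proof. by move=> s t u; apply: section_eq => p; rewrite /= addrA. Qed.
Lemma section_addC : commutative section_add.
Proof. by move=> s t; apply: section_eq => p; rewrite /= addrC. Qed.
Lemma section_add0 : left_id section_zero section_add.
Proof. by move=> s; apply: section_eq => p; rewrite /= add0r. Qed.
Lemma section_addN : left_inverse section_zero section_opp section_add.
Proof. by move=> s; apply: section_eq => p; rewrite /= scaleN1r addNr. Qed.

HB.instance Definition _ := GRing.isZmodule.Build section
  section_addA section_addC section_add0 section_addN.
HB.instance Definition _ := isPointed.Build section 0.

Lemma section_scaleA f g s :
  section_scale f (section_scale g s) = section_scale (f * g) s.
Proof. by apply: section_eq => p; rewrite /= scalerA. Qed.
Lemma section_scale1 : left_id 1 section_scale.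
Proof. by move=> s; apply: section_eq => p; rewrite /= scale1r. Qed.
Lemma section_scaleDr : right_distributive section_scale +%R.
Proof. by move=> f s t; apply: section_eq => p; rewrite /= scalerDr. Qed.
Lemma section_scaleDl s : {morph section_scale^~ s : f g / f + g}.
Proof. by move=> f g; apply: section_eq => p; rewrite /= scalerDl. Qed.

HB.instance Definition _ := GRing.Zmodule_isLmodule.Build (smooth_fun M) section
  section_scaleA section_scale1 section_scaleDr section_scaleDl.

End Sections.

Section TangentBundle.
Context {R : realType} {n : nat}.
Variable M : manifold R n.

Definition smooth_vector_field : set (forall p : M, tangent p) :=
  [set X | forall f : smooth_fun M, (fun p => X p f) \in @smooth R n M].

Lemma smooth_vector_field0 : smooth_vector_field (fun=> 0).
Proof. by move=> f; exact: (valP (0 : smooth_fun M)). Qed.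

Lemma smooth_vector_fieldP (h : smooth_fun M) X Y :
  smooth_vector_field X -> smooth_vector_field Y ->
  smooth_vector_field (fun p => h p *: X p + Y p).
Proof.
by move=> Xs Ys f; exact: (valP (h * SmoothFun (Xs f) + SmoothFun (Ys f))).
Qed.

Definition tangent_bundle : bundle M :=
  @Bundle R n M (fun p => tangent p) smooth_vector_field
    smooth_vector_field0 smooth_vector_fieldP.

Definition vector_field := section tangent_bundle.

Definition vf_apply (X : vector_field) (f : smooth_fun M) : smooth_fun M :=
  SmoothFun (sectionP X f).

Lemma bracket_subproof (X Y : vector_field) p :
  (fun f => (X p : tangent p) (vf_apply Y f) - (Y p : tangent p) (vf_apply X f))
    \in derivation p.
Proof.
have lin (Z : vector_field) a f g :
    vf_apply Z (a *: f + g) = a *: vf_apply Z f + vf_apply Z g.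
  apply/val_inj/funext => q /=.
  by have /asboolP[-> _] := tangentP (Z q : tangent q).
have mul (Z : vector_field) f g :
    vf_apply Z (f * g) = f * vf_apply Z g + g * vf_apply Z f.
  apply/val_inj/funext => q /=.
  by have /asboolP[_ ->] := tangentP (Z q : tangent q).
have /asboolP[Xl Xm] := tangentP (X p : tangent p).
have /asboolP[Yl Ym] := tangentP (Y p : tangent p).
have XD f g : (X p : tangent p) (f + g) =
    (X p : tangent p) f + (X p : tangent p) g.
  by rewrite -[f]scale1r Xl mul1r scale1r.
have YD f g : (Y p : tangent p) (f + g) =
    (Y p : tangent p) f + (Y p : tangent p) g.
  by rewrite -[f]scale1r Yl mul1r scale1r.
apply/asboolP; split=> [a f g|f g].
- by rewrite !lin Xl Yl; ring.
- by rewrite !mul XD YD !Xm !Ym /=; ring.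
Qed.

Lemma bracket_smooth (X Y : vector_field) :
  smooth_vector_field (fun p => Tangent (bracket_subproof X Y p)).
Proof.
move=> f.
exact: (valP (vf_apply X (vf_apply Y f) - vf_apply Y (vf_apply X f))).
Qed.

Definition bracket (X Y : vector_field) : vector_field :=
  @MkSection R n M tangent_bundle _ (bracket_smooth X Y).

End TangentBundle.

Section VectorBundle.
Context {R : realType} {n : nat}.
Variable M : manifold R n.

(* [triv_coord] and [triv_vec] are only meaningful over [triv_dom].  The rank
   belongs to the trivialization, so it is locally constant on [M]. *)
Record local_triv (E : M -> lmodType R) := LocalTriv {
  triv_dom : set M;
  triv_rank : nat;
  triv_coord : forall p, {linear E p -> 'rV[R]_triv_rank};
  triv_vec : forall p, 'rV[R]_triv_rank -> E p;
  triv_dom_open : open triv_dom;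
  triv_coordK : forall p, triv_dom p -> cancel (triv_coord p) (triv_vec p);
  triv_vecK : forall p, triv_dom p -> cancel (triv_vec p) (triv_coord p) }.

Arguments triv_coord {E} l p.
Arguments triv_vec {E} l p _.

Record vector_bundle := VectorBundle {
  vb_fibre :> M -> lmodType R;
  vb_triv : set (local_triv vb_fibre);
  vb_cover : forall p, exists2 t, vb_triv t & triv_dom t p;
  vb_compat : forall s t p, vb_triv s -> vb_triv t ->
    triv_dom s p -> triv_dom t p ->
    forall w j, msmooth_at p (fun q => triv_coord t q (triv_vec s q w) ord0 j) }.

Definition smooth_vb_section (E : vector_bundle) : set (forall p, E p) :=
  [set s | forall t p, @vb_triv E t -> triv_dom t p ->
     forall j, msmooth_at p (fun q => triv_coord t q (s q) ord0 j)].

Lemma smooth_vb_section0 E : @smooth_vb_section E (fun=> 0).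
Proof.
move=> t p _ _ j; rewrite (_ : (fun q => _) = cst 0); last first.
  by apply/funext => q; rewrite linear0 mxE.
exact: msmooth_at_cst.
Qed.

Lemma smooth_vb_sectionP E (f : smooth_fun M) s t :
  smooth_vb_section s -> smooth_vb_section t ->
  @smooth_vb_section E (fun p => f p *: s p + t p).
Proof.
move=> ss ts u p Eu up j.
rewrite (_ : (fun q => _) =
    (f : M -> R) * (fun q => triv_coord u q (s q) ord0 j) +
    (fun q => triv_coord u q (t q) ord0 j)); last first.
  by apply/funext => q; rewrite linearP !mxE.
by apply: msmooth_atD (ts _ _ Eu up j); apply: msmooth_atM (ss _ _ Eu up j);
  exact: smooth_fun_at.
Qed.

Definition bundle_of_vector_bundle (E : vector_bundle) : bundle M :=
  Bundle (@smooth_vb_section0 E) (@smooth_vb_sectionP E).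

End VectorBundle.
Coercion bundle_of_vector_bundle : vector_bundle >-> bundle.

Section MetricsConnections.
Context {R : realType} {n : nat} {M : manifold R n}.
Implicit Type E : bundle M.

Record fibre_metric E := FibreMetric {
  fm_val :> forall p, E p -> E p -> R;
  fm_linear : forall p a (u v w : E p),
    fm_val (a *: u + v) w = a * fm_val u w + fm_val v w;
  fm_sym : forall p (u v : E p), fm_val u v = fm_val v u;
  fm_pos : forall p (u : E p), u != 0 -> 0 < fm_val u u;
  fm_smooth : forall s t : section E,
    (fun p => fm_val (s p) (t p)) \in @smooth R n M }.

Definition fm_fun E (g : fibre_metric E) (s t : section E) : smooth_fun M :=
  SmoothFun (fm_smooth g s t).

Record connection E := Connection {
  conn_val :> forall p, tangent p -> section E -> E p;
  conn_linear : forall p a (u v : tangent p) s,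
    conn_val (a *: u + v) s = a *: conn_val u s + conn_val v s;
  conn_add : forall p (v : tangent p) s t,
    conn_val v (s + t) = conn_val v s + conn_val v t;
  conn_leibniz : forall p (v : tangent p) (f : smooth_fun M) (s : section E),
    conn_val v (f *: s) = v f *: s p + f p *: conn_val v s;
  conn_smooth : forall (X : vector_field M) s,
    smooth_section (fun p => conn_val (X p) s) }.

Definition covd E (D : connection E) (X : vector_field M) (s : section E) :
  section E := MkSection (conn_smooth D X s).

Definition metric_connection E (g : fibre_metric E) (D : connection E) :=
  forall p (v : tangent p) s t,
    v (fm_fun g s t) = g p (D p v s) (t p) + g p (s p) (D p v t).

Definition torsion_free (D : connection (tangent_bundle M)) :=
  forall X Y, covd D X Y - covd D Y X = bracket X Y.

Definition levi_civita (g : fibre_metric (tangent_bundle M)) D :=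
  metric_connection g D /\ torsion_free D.

Definition curvature E (D : connection E) (X Y : vector_field M)
    (s : section E) : section E :=
  covd D X (covd D Y s) - covd D Y (covd D X s) - covd D (bracket X Y) s.

End MetricsConnections.

(* [A], with [i], is the Clifford algebra of [(V, q)], with i(v)^2 = - q(v). *)
Definition is_clifford_algebra (R : realType) (V : lmodType R) (q : V -> R)
    (A : algType R) (i : {linear V -> A}) :=
  (forall v, i v * i v = - (q v)%:A) /\
  (forall (B : algType R) (h : {linear V -> B}),
     (forall v, h v * h v = - (q v)%:A) ->
     exists phi : {lrmorphism A -> B}, (forall v, phi (i v) = h v) /\
       forall psi : {lrmorphism A -> B}, (forall v, psi (i v) = h v) ->
         psi =1 phi).

Section Clifford.
Context {R : realType} {n : nat} {M : manifold R n}.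
Variable g : fibre_metric (tangent_bundle M).

(* The fibres are determined up to a unique isomorphism. *)
Record clifford_family := CliffordFamily {
  cl_fibre :> M -> algType R;
  cl_incl : forall p, {linear tangent p -> cl_fibre p};
  cl_clifford : forall p, is_clifford_algebra (fun v => g p v v) (cl_incl p) }.

Variable C : clifford_family.

Definition cl_expand (w : seq (smooth_fun M * seq (vector_field M))) p : C p :=
  \sum_(x <- w) x.1 p *: \prod_(X <- x.2) cl_incl C p (X p).

(* The smooth structure of the Clifford bundle is the one for which Clifford
   products of smooth vector fields are smooth and span the smooth sections. *)
Definition smooth_cl_section : set (forall p, C p) :=
  [set a | forall p : M, exists w, \forall q \near p, a q = cl_expand w q].

Lemma smooth_cl_section0 : smooth_cl_section (fun=> 0).
Proof. by move=> p; exists [::]; apply: nearW => q; rewrite /cl_expand big_nil. Qed.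

Lemma smooth_cl_sectionP (f : smooth_fun M) a b :
  smooth_cl_section a -> smooth_cl_section b ->
  smooth_cl_section (fun p => f p *: a p + b p).
Proof.
move=> sa sb p; have [u ua] := sa p; have [v vb] := sb p.
exists ([seq (f * x.1, x.2) | x <- u] ++ v).
apply: filterS2 ua vb => q -> ->; rewrite /cl_expand big_cat big_map scaler_sumr.
by congr (_ + _); apply: eq_bigr => x _; rewrite /= scalerA.
Qed.

Definition clifford_bundle : bundle M :=
  @Bundle R n M (fun p => C p) smooth_cl_section
    smooth_cl_section0 smooth_cl_sectionP.

Lemma smooth_cl_sectionM (a b : section clifford_bundle) :
  smooth_cl_section (fun p => (a p : C p) * (b p : C p)).
Proof.
move=> p; have [u ua] := sectionP a p; have [v vb] := sectionP b p.
exists [seq (x.1 * y.1, x.2 ++ y.2) | x <- u, y <- v].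
apply: filterS2 ua vb => q -> ->; rewrite /cl_expand big_allpairs_dep big_distrlr.
apply: eq_bigr => x _; apply: eq_bigr => y _ /=.
by rewrite big_cat /= -scalerAl -scalerAr scalerA.
Qed.

Definition cl_mul (a b : section clifford_bundle) : section clifford_bundle :=
  @MkSection R n M clifford_bundle _ (smooth_cl_sectionM a b).

Lemma smooth_cl_section_vf (X : vector_field M) :
  smooth_cl_section (fun p => cl_incl C p (X p)).
Proof.
move=> p; exists [:: (1, [:: X])].
by apply: nearW => q; rewrite /cl_expand big_seq1 /= big_seq1 scale1r.
Qed.

Definition cl_vf (X : vector_field M) : section clifford_bundle :=
  @MkSection R n M clifford_bundle _ (smooth_cl_section_vf X).

(* The connection induced on the Clifford bundle by a connection on [TM]: the
   unique one extending it that is a derivation of the Clifford product. *)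
Definition induced_connection (D : connection (tangent_bundle M))
    (DC : connection clifford_bundle) :=
  (forall p (v : tangent p) X, DC p v (cl_vf X) = cl_incl C p (D p v X)) /\
  (forall p (v : tangent p) a b,
     DC p v (cl_mul a b) =
     (DC p v a : C p) * (b p : C p) + (a p : C p) * (DC p v b : C p)).

Record dirac_bundle (DC : connection clifford_bundle) := DiracBundle {
  db_bundle :> vector_bundle M;
  cmul : forall p, C p -> db_bundle p -> db_bundle p;
  cmul_linearl : forall p r (a b : C p) (s : db_bundle p),
    cmul (r *: a + b) s = r *: cmul a s + cmul b s;
  cmul_linearr : forall p r (a : C p) (s t : db_bundle p),
    cmul a (r *: s + t) = r *: cmul a s + cmul a t;
  cmul1 : forall p (s : db_bundle p), cmul (1 : C p) s = s;
  cmulA : forall p (a b : C p) (s : db_bundle p),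
    cmul (a * b) s = cmul a (cmul b s);
  cmul_smooth : forall (a : section clifford_bundle) (s : section db_bundle),
    @smooth_section _ _ _ db_bundle (fun p => cmul (a p : C p) (s p));
  db_metric : fibre_metric db_bundle;
  db_conn : connection db_bundle;
  db_conn_metric : metric_connection db_metric db_conn;
  cmul_skew : forall p (X : tangent p) (s t : db_bundle p),
    db_metric p (cmul (cl_incl C p X) s) t +
    db_metric p s (cmul (cl_incl C p X) t) = 0;
  cmul_leibniz : forall p (v : tangent p) a s,
    db_conn p v (MkSection (cmul_smooth a s)) =
    cmul (DC p v a : C p) (s p) + cmul (a p : C p) (db_conn p v s) }.

End Clifford.

Section DiracOperator.
Context {R : realType} {n : nat} {M : manifold R n}.
Context {g : fibre_metric (tangent_bundle M)} {C : clifford_family g}.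
Context {DC : connection (clifford_bundle C)}.
Variable S : dirac_bundle DC.

(* Vector fields on [M] forming an orthonormal frame of [TM] near [p]. *)
Definition orthonormal_frame_at (p : M) : set ('I_n -> vector_field M) :=
  [set e | \forall q \near p, forall i j, g q (e i q) (e j q) = (i == j)%:R].

(* Orthonormal frames near [p], and sections through a given vector, always
   exist, and neither of the two operators below depends on their choice. *)
Definition frame_at (p : M) : 'I_n -> vector_field M :=
  get (orthonormal_frame_at p).

Definition section_through (p : M) (v : S p) : section S :=
  get [set s : section S | s p = v].

Definition vmul (p : M) (X : tangent p) (v : S p) : S p :=
  cmul (cl_incl C p X) v.

Definition dirac_op (s : section S) (p : M) : S p :=
  let e := frame_at p in \sum_(i < n) vmul (e i p) (db_conn S p (e i p) s).

Definition weitzenbock (p : M) (v : S p) : S p :=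
  let e := frame_at p in
  \sum_(i < n) \sum_(j < n | (i < j)%N)
    vmul (e i p) (vmul (e j p)
      (curvature (db_conn S) (e i) (e j) (section_through v) p)).

Definition weitzenbock_psd_at (p : M) :=
  forall v : S p, 0 <= db_metric S p (weitzenbock v) v.

Definition weitzenbock_pd_at (p : M) :=
  forall v : S p, v != 0 -> 0 < db_metric S p (weitzenbock v) v.

Definition parallel (s : section S) :=
  forall p (X : tangent p), db_conn S p X s = 0.

End DiracOperator.

(* Main.v *)
Require Import Defs.
From mathcomp Require Import all_boot all_order all_algebra.
From mathcomp Require Import all_classical all_reals all_analysis.
From mathcomp Require Import ring lra.
Set Implicit Arguments. Unset Strict Implicit. Unset Printing Implicit Defensive.
Import Order.TTheory GRing.Theory Num.Theory numFieldNormedType.Exports.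
Local Open Scope classical_set_scope.
Local Open Scope ring_scope.

(** If [D s = 0], differentiating [sum_k e_k . nabla_(e_k) s = 0] along [e_i] and
    multiplying by [e_i] gives [tr (nabla^2 s) = R s], hence
    [laplace |s|^2 = 2 <R s, s> + 2 |nabla s|^2 >= 0]. A subharmonic function on a
    compact manifold is constant on every connected component by Hopf's strong
    maximum principle, so both terms vanish; no integration is needed. If moreover
    [R] is definite at [p], then [s p = 0], and [|s|] is constant.

    Tangent vectors are derivations of the algebra of global smooth functions:
    bump functions make them local, and Hadamard's lemma makes the partial
    derivatives span them. *)

(** * Smooth functions on open subsets of R^n *)

(** The operators take their frame from [frame_at p], chosen anew at every point. Bochner's formula,
    however, differentiates a single frame around [p], and the maximum principle needs the Laplacian
    on a whole neighbourhood. This is why traces are shown to be independent of the orthonormal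
    frame. The frame is not taken parallel at [p]: its connection coefficients are carried along and
    cancel because they are skew. Smoothness means differentiability of all iterated directional
    derivatives. No formula for these is ever computed; each construction (composition, flat
    functions, division by a coordinate) exhibits a class of functions closed under differentiation.
    Connectedness enters the second claim because [s p = 0] propagates only within the component of
    [p]; on a disjoint union a nonzero parallel section may live on another component. *)

Lemma near_forall (T : topologicalType) (x : T) (I : finType) (P : I -> T -> Prop) :
  (forall i, \forall y \near x, P i y) -> \forall y \near x, forall i, P i y.
Proof. exact: filter_forall. Qed.

Section SmoothOn.
Context {R : realType} {n : nat}.
Local Notation V := 'rV[R]_n.
Implicit Types (U : set V) (f g : V -> R) (x y v : V).

Definition smooth_on U f :=
  forall y, U y -> forall vs, differentiable (iter_derive vs f) y.

Lemma smooth_atE x f :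
  smooth_at x f <-> exists U, [/\ open U, U x & smooth_on U f].
Proof.
split=> [|[U [oU Ux fU]]].
  rewrite /smooth_at -nbhs_nearE nbhsE => -[U [oU Ux] UP].
  by exists U; split => // y /UP.
by apply: (@filterS _ _ _ U); [move=> y /fU|exact: open_nbhs_nbhs].
Qed.

(** [G] is meant to be a family whose derivatives are polynomials in its members with smooth
    coefficients, such as all composites with a fixed map. Equality is required on [U] only, so
    values outside [U] are free. *)
Inductive generated U (G : set (V -> R)) : (V -> R) -> Prop :=
| gen_base f of G f : generated U G f
| gen_smooth f of smooth_on U f : generated U G f
| gen_add f g of generated U G f & generated U G g : generated U G (f + g)
| gen_mul f g of generated U G f & generated U G g : generated U G (f * g)
| gen_eq f g of generated U G f & (forall y, U y -> f y = g y) :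
    generated U G g.

Lemma open_near_eq U f g y : open U -> (forall z, U z -> f z = g z) ->
  U y -> {near y, f =1 g}.
Proof.
move=> oU fg Uy; apply: (@filterS _ _ _ U) => //.
by apply: open_nbhs_nbhs; split.
Qed.

(* Closing [G] under sums and products and under derivatives suffices, since a
   differentiability proof is then only needed for the generators. *)
Lemma generated_smooth_on U G : open U ->
  (forall f y, G f -> U y -> differentiable f y) ->
  (forall f v, G f -> generated U G (fun x => 'D_v f x)) ->
  forall f, generated U G f -> smooth_on U f.
Proof.
move=> oU Gd GD.
have gd f y : generated U G f -> U y -> differentiable f y.
  move=> Gf Uy; elim: Gf => {f} [f fG|f fU|f g _ + _|f g _ + _|f g _ fx fg].
  - exact: Gd.
  - exact: (fU y Uy [::]).
  - exact: differentiableD.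
  - exact: differentiableM.
  - apply: near_eq_differentiable fx; exact: open_near_eq Uy.
have gD f v : generated U G f -> generated U G (fun x => 'D_v f x).
  elim=> {f} [f /GD|f fU|f g Gf Df Gg Dg|f g Gf Df Gg Dg|f g Gf Df fg].
  - exact.
  - by apply: gen_smooth => y Uy vs; exact: (fU y Uy (v :: vs)).
  - apply: gen_eq (gen_add Df Dg) _ => y Uy.
    by rewrite deriveD //; exact/diff_derivable/gd.
  - apply: gen_eq (gen_add (gen_mul Gf Dg) (gen_mul Gg Df)) _ => y Uy.
    by rewrite deriveM //; exact/diff_derivable/gd.
  - apply: gen_eq Df _ => y Uy; apply: near_eq_derive; exact: open_near_eq Uy.
move=> f + y Uy vs; elim: vs f => [|v vs IH] f Gf /=; first exact: gd.
exact/IH/gD.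
Qed.

Lemma smooth_on_cst U (a : R) : smooth_on U (cst a).
Proof.
move=> y _ vs; elim: vs a => [|v vs IH] a /=; first exact: differentiable_cst.
rewrite (_ : (fun x => 'D_v (cst a) x) = cst 0) //.
by apply/funext => z; rewrite derive_cst.
Qed.

Lemma smooth_on_generated0 U f : open U -> generated U set0 f -> smooth_on U f.
Proof. by move=> oU; apply: generated_smooth_on. Qed.

Lemma smooth_onD U f g : open U ->
  smooth_on U f -> smooth_on U g -> smooth_on U (f + g).
Proof.
by move=> oU fU gU; apply: smooth_on_generated0 => //; apply: gen_add; exact: gen_smooth.
Qed.

Lemma smooth_onM U f g : open U ->
  smooth_on U f -> smooth_on U g -> smooth_on U (f * g).
Proof.
by move=> oU fU gU; apply: smooth_on_generated0 => //; apply: gen_mul; exact: gen_smooth.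
Qed.

Lemma smooth_on_eq U f g : open U -> (forall y, U y -> f y = g y) ->
  smooth_on U f -> smooth_on U g.
Proof.
by move=> oU fg fU; apply: smooth_on_generated0 => //; apply: gen_eq fg; exact: gen_smooth.
Qed.

Lemma smooth_onS U W f : W `<=` U -> smooth_on U f -> smooth_on W f.
Proof. by move=> WU fU y /WU; exact: fU. Qed.

Lemma smooth_on_derive U f v : smooth_on U f -> smooth_on U (fun x => 'D_v f x).
Proof. by move=> fU y Uy vs; exact: (fU y Uy (v :: vs)). Qed.

Lemma smooth_on_diff U f y : smooth_on U f -> U y -> differentiable f y.
Proof. by move=> fU Uy; exact: (fU y Uy [::]). Qed.

Lemma smooth_on_cst_derive U (f : V -> R) : open U -> (forall y, U y -> differentiable f y) ->
  (forall v, exists a, forall y, U y -> 'D_v f y = a) -> smooth_on U f.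
Proof.
move=> oU df Df; apply: (@generated_smooth_on _ [set f]) => //.
- by move=> _ y ->; exact: df.
- move=> _ v ->; have [a Ha] := Df v.
  apply: gen_eq (gen_smooth _ (@smooth_on_cst _ a)) _ => y Uy.
  by rewrite Ha.
- exact: gen_base.
Qed.

Lemma derive_coord j y v : 'D_v (fun x : V => x ord0 j) y = v ord0 j.
Proof.
apply/cvg_lim => //; apply: cvg_near_cst; near=> h.
have h0 : h != 0 by near: h; exact: nbhs_dnbhs_neq.
by rewrite /= !mxE addrK -[_ *: _]/(_ * _) mulKf.
Unshelve. all: by end_near. Qed.

Lemma smooth_on_coord U j : open U -> smooth_on U (fun x : V => x ord0 j).
Proof.
move=> oU; apply: smooth_on_cst_derive => // [y _|v]; first exact: differentiable_coord.
by exists (v ord0 j) => y _; exact: derive_coord.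
Qed.

Lemma smooth_on_coordD j (a : R) :
  smooth_on setT ((fun x : V => x ord0 j) + cst a).
Proof.
apply: smooth_onD; [exact: openT| |exact: smooth_on_cst].
by apply: smooth_on_coord; exact: openT.
Qed.

Lemma smooth_on_sum U (I : Type) (r : seq I) (P : pred I) (F : I -> V -> R) :
  open U -> (forall i, P i -> smooth_on U (F i)) ->
  smooth_on U (fun x => \sum_(i <- r | P i) F i x).
Proof.
move=> oU FU; elim: r => [|i r IH].
  by apply: smooth_on_eq (@smooth_on_cst U 0) => // y _; rewrite big_nil.
have [Pi|nPi] := boolP (P i).
  apply: smooth_on_eq (smooth_onD oU (FU i Pi) IH) => // y _.
  by rewrite big_cons Pi.
by apply: smooth_on_eq IH => // y _; rewrite big_cons (negbTE nPi).
Qed.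

End SmoothOn.

(** * The chain rule and towers of one-variable functions *)

Section Chain.
Context {R : realType}.

Lemma row_sum_delta n (w : 'rV[R]_n) : w = \sum_j w ord0 j *: delta_mx ord0 j.
Proof. by rewrite {1}[w]matrix_sum_delta big_ord1. Qed.

Lemma derive_delta n (f : 'rV[R]_n -> R) x v : differentiable f x ->
  'D_v f x = \sum_j v ord0 j * 'D_(delta_mx ord0 j) f x.
Proof.
move=> df; rewrite deriveE // {1}[v]row_sum_delta linear_sum.
by apply: eq_bigr => j _; rewrite linearZ deriveE.
Qed.

Lemma differentiable_row n m (c : 'rV[R]_n -> 'rV[R]_m) x :
  (forall j, differentiable (fun y => c y ord0 j) x) -> differentiable c x.
Proof.
move=> dc; rewrite (_ : c = \sum_j (fun y => c y ord0 j *: delta_mx ord0 j)).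
  by apply: differentiable_sum => j; apply: differentiableZl.
by apply/funext => y; rewrite fct_sumE -row_sum_delta.
Qed.

Lemma derive_row n m (c : 'rV[R]_n -> 'rV[R]_m) x v j : differentiable c x ->
  ('D_v c x) ord0 j = 'D_v (fun y => c y ord0 j) x.
Proof. by move=> dc; rewrite derive_mx ?mxE //; exact: diff_derivable. Qed.

(** The generators are all [h \o c] with [h] smooth on [W]. The chain rule writes a derivative of
    [h \o c] as a sum of products of a generator (a partial derivative of [h] composed with [c]) and
    a derivative of a component of [c]. *)
Lemma smooth_on_comp n m (U : set 'rV[R]_n) (W : set 'rV[R]_m)
    (c : 'rV[R]_n -> 'rV[R]_m) (f : 'rV[R]_m -> R) :
  open U -> (forall y, U y -> W (c y)) ->
  (forall j, smooth_on U (fun y => c y ord0 j)) ->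
  smooth_on W f -> smooth_on U (f \o c).
Proof.
move=> oU UW cU fW.
have dc y : U y -> differentiable c y.
  by move=> Uy; apply: differentiable_row => j; exact: smooth_on_diff Uy.
apply: (@generated_smooth_on _ _ U [set h \o c | h in [set h | smooth_on W h]]) => //.
- move=> _ y [h hW <-] Uy; apply: differentiable_comp; first exact: dc.
  by apply: smooth_on_diff hW _; exact: UW.
- move=> _ v [h hW <-].
  pose F j : 'rV[R]_n -> R := ((fun x => 'D_(delta_mx ord0 j) h x) \o c) *
    (fun y => 'D_v (fun y => c y ord0 j) y).
  have GF j : generated U [set h \o c | h in [set h | smooth_on W h]] (F j).
    apply: gen_mul; last by apply: gen_smooth; exact: smooth_on_derive.
    by apply: gen_base; exists (fun x => 'D_(delta_mx ord0 j) h x) => //;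
      exact: smooth_on_derive.
  apply: (@gen_eq _ _ _ _ (fun y => \sum_(j <- index_enum _) F j y)); last first.
    move=> y Uy; have dh : differentiable h (c y).
      by apply: smooth_on_diff hW _; exact: UW.
    rewrite (deriveE _ (differentiable_comp (dc _ Uy) dh)).
    rewrite (diff_comp (dc _ Uy) dh) /= -(deriveE _ dh) (derive_delta _ dh).
    apply: eq_bigr => j _; rewrite /F -(deriveE _ (dc _ Uy)).
    by rewrite (derive_row _ _ (dc _ Uy)) mulrC.
  elim: (index_enum _) => [|j r IH].
    apply: gen_eq (gen_smooth _ (@smooth_on_cst _ _ U 0)) _ => y _.
    by rewrite big_nil.
  by apply: gen_eq (gen_add (GF j) IH) _ => y _; rewrite big_cons.
- by apply: gen_base; exists f.
Qed.

Lemma smooth_at_comp n m (c : 'rV[R]_n -> 'rV[R]_m) (f : 'rV[R]_m -> R) x :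
  (forall j, smooth_at x (fun y => c y ord0 j)) ->
  smooth_at (c x) f -> smooth_at x (f \o c).
Proof.
move=> cx /smooth_atE[W [oW Wx fW]].
have /fin_all_exists[U UP] j := (smooth_atE _ _).1 (cx j).
have dc : \forall y \near x, forall j, smooth_at y (fun y => c y ord0 j).
  apply: near_forall => j; have [oU Ux cU] := UP j.
  have : nbhs x (U j) by exact: open_nbhs_nbhs.
  by apply: filterS => y Uy; apply/smooth_atE; exists (U j).
have cc : {for x, continuous c}.
  apply: differentiable_continuous; apply: differentiable_row => j.
  by have [oU Ux cU] := UP j; exact: smooth_on_diff Ux.
have : \forall y \near x, W (c y) /\ forall j, smooth_at y (fun y => c y ord0 j).
  apply: filterI => //; apply: cc; exact: open_nbhs_nbhs.
rewrite -nbhs_nearE nbhsE => -[Z [oZ Zx] ZP].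
apply/smooth_atE; exists Z; split=> //.
apply: (@smooth_on_comp _ _ _ W) => // [y /ZP[]//|j y /ZP[_ /(_ j)]].
by move=> /nbhs_singleton.
Qed.

Lemma derive_comp1 n (f : 'rV[R]_n -> R) (phi : R -> R) d y v :
  differentiable f y -> is_derive (f y) 1 phi d ->
  differentiable (phi \o f) y /\ 'D_v (phi \o f) y = d * 'D_v f y.
Proof.
move=> df dphi; have dp : differentiable phi (f y) by apply/derivable1_diffP.
split; first exact: differentiable_comp.
rewrite (deriveE _ (differentiable_comp df dp)) (diff_comp df dp) /=.
by rewrite (diff1E dp) derive1E derive_val -(deriveE _ df) mulrC.
Qed.

(** The two-step recursion covers both uses: [t^(-k/2)] has [a k = 0] and [b k = -k/2], while
    [t^(-k) exp(-1/t)] has [a k = -k] and [b k = 1]. *)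
Lemma smooth_on_tower n (U : set 'rV[R]_n) (f : 'rV[R]_n -> R)
    (phi : nat -> R -> R) (a b : nat -> R) (J : set R) :
  open U -> smooth_on U f -> (forall y, U y -> J (f y)) ->
  (forall k t, J t ->
     is_derive t 1 (phi k) (a k * phi k.+1 t + b k * phi k.+2 t)) ->
  forall k, smooth_on U (phi k \o f).
Proof.
move=> oU fU UJ dphi k; pose G := [set phi k \o f | k in setT].
apply: (@generated_smooth_on _ _ U G) => //.
- move=> _ y [i _ <-] Uy.
  by have [] := derive_comp1 0 (smooth_on_diff fU Uy) (dphi i _ (UJ y Uy)).
- move=> _ v [i _ <-].
  have Gk j : generated U G (phi j \o f) by apply: gen_base; exists j.
  have gc c : generated U G (cst c) by apply: gen_smooth; exact: smooth_on_cst.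
  apply: gen_eq (gen_mul (gen_add (gen_mul (gc (a i)) (Gk i.+1))
     (gen_mul (gc (b i)) (Gk i.+2))) (gen_smooth _ (smooth_on_derive v fU))) _.
  move=> y Uy.
  by have [_ ->] := derive_comp1 v (smooth_on_diff fU Uy) (dphi i _ (UJ y Uy)).
- by apply: gen_base; exists k.
Qed.

End Chain.

(** * Reciprocal square roots and flat functions *)

Section OneVariable.
Context {R : realType}.

Lemma is_derive_rsqrtX k (t : R) : 0 < t ->
  is_derive t 1 (fun t => (Num.sqrt t)^-1 ^+ k)
    (- (k%:R / 2) * (Num.sqrt t)^-1 ^+ k.+2).
Proof.
move=> t0; have s0 : Num.sqrt t != 0 by rewrite gt_eqF ?sqrtr_gt0.
have ds := is_derive1_sqrt t0.
have dV : is_derive t 1 (fun t => (Num.sqrt t)^-1)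
    (- (Num.sqrt t) ^- 2 * (2 * Num.sqrt t)^-1).
  apply: DeriveDef; first by apply: derivableV => //; exact: ex_derive.
  by rewrite deriveV ?derive_val //; exact: ex_derive.
have := is_deriveX k dV.
set g := (X in is_derive _ _ X _).
rewrite (_ : g = (fun t => (Num.sqrt t)^-1 ^+ k)); last first.
  by rewrite /g fctE.
move=> dX; apply: is_derive_eq dX _ => /=.
rewrite /GRing.scale /=; case: k {g} => [|k]; first by rewrite !(mul0r, oppr0).
rewrite (invfM 2) -exprVn !exprS expr0 /=; set s := (Num.sqrt t)^-1.
by ring.
Qed.

Lemma smooth_on_rsqrt n (U : set 'rV[R]_n) (f : 'rV[R]_n -> R) :
  open U -> smooth_on U f -> (forall y, U y -> 0 < f y) ->
  smooth_on U (fun x => (Num.sqrt (f x))^-1).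
Proof.
move=> oU fU f0.
have := @smooth_on_tower _ _ U f (fun k t => (Num.sqrt t)^-1 ^+ k) (fun=> 0)
  (fun k => - (k%:R / 2)) [set t | 0 < t] oU fU f0.
move=> /(_ _)/(_ 1%N); apply => k t t0.
by apply: is_derive_eq (is_derive_rsqrtX k t0) _; rewrite mul0r add0r.
Qed.

(** The reciprocal is the square of the reciprocal square root. *)
Lemma smooth_on_inv n (U : set 'rV[R]_n) (f : 'rV[R]_n -> R) :
  open U -> smooth_on U f -> (forall y, U y -> 0 < f y) ->
  smooth_on U (fun x => (f x)^-1).
Proof.
move=> oU fU f0; have sU := smooth_on_rsqrt oU fU f0.
apply: smooth_on_eq (smooth_onM oU sU sU) => // y Uy.
by rewrite /= fctE -invfM -expr2 sqr_sqrtr // ltW // f0.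
Qed.

(** [flat 0] is the standard function [exp(-1/t)], flat at 0; the powers of [1/t] are included
    because differentiation produces them. *)
Definition flat k (t : R) := if 0 < t then t^-1 ^+ k * expR (- t^-1) else 0.

(** Bounding [exp(1/t)] below by the term of degree [k + 2] of its series absorbs [t^(-k)] and
    leaves a factor [t^2], so that difference quotients at 0 tend to 0 for every [k]. *)
Lemma flat_le k t : `|flat k t| <= k.+2`!%:R * `|t| ^+ 2.
Proof.
rewrite /flat; case: ifPn => t0; last by rewrite normr0 mulr_ge0.
have tV0 : 0 < t^-1 by rewrite invr_gt0.
rewrite ger0_norm ?mulr_ge0 ?exprn_ge0 ?expR_ge0 ?(ltW tV0) //.
rewrite (ger0_norm (ltW t0)) expRN.
have := expR_ge1Dxn k.+1 (ltW tV0) => eb.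
have {}eb : t^-1 ^+ k.+2 / k.+2`!%:R <= expR t^-1.
  by apply: le_trans eb; rewrite lerDr.
have f0 : 0 < k.+2`!%:R :> R by rewrite ltr0n fact_gt0.
rewrite ler_pdivrMr ?expR_gt0 //.
rewrite ler_pdivrMr // in eb.
have -> : t^-1 ^+ k = t ^+ 2 * t^-1 ^+ k.+2.
  rewrite !exprS expr0 mulr1; field; exact: lt0r_neq0.
rewrite (_ : _ * _ * expR _ = t ^+ 2 * (expR t^-1 * k.+2`!%:R)); last by ring.
exact: ler_wpM2l (exprn_ge0 2 (ltW t0)) _ _ eb.
Qed.

Lemma is_derive_flat k (t : R) :
  is_derive t 1 (flat k) (- k%:R * flat k.+1 t + 1 * flat k.+2 t).
Proof.
have [t0|t0|->] := ltgtP t 0.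
- have -> : - k%:R * flat k.+1 t + 1 * flat k.+2 t = 0.
    by rewrite /flat (le_gtF (ltW t0)) !mulr0 addr0.
  apply: near_eq_is_derive (is_derive_cst (0 : R) t 1).
  near=> s; rewrite /flat le_gtF //; apply: ltW; near: s; exact: lt_nbhsl.
- have dV : is_derive t 1 (fun t : R => t^-1) (- t ^- 2).
    apply: DeriveDef; first by apply: derivableV => //; rewrite gt_eqF.
    by rewrite deriveV ?gt_eqF // derive_id [LHS]mulr1.
  have dE : is_derive t 1 (fun t => expR (- t^-1)) (expR (- t^-1) * t ^- 2).
    have dN : is_derive t 1 (fun t : R => - t^-1) (t ^- 2).
      by have d := is_deriveN dV; apply: is_derive_eq d _; rewrite opprK.
    exact: (@is_derive1_comp R expR (fun t => - t^-1)).
  have := is_deriveM (is_deriveX k dV) dE.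
  set g := (X in is_derive _ _ X _) => dg.
  apply: (@near_eq_is_derive _ _ _ g); last first.
    apply: is_derive_eq dg _; rewrite /flat t0 /GRing.scale /= !fctE.
    rewrite -!exprVn; case: k g => [|k] _ /=; rewrite !exprS !expr0; ring.
  near=> s; rewrite /g !fctE /flat ifT //; near: s; exact: lt_nbhsr.
- have -> : - k%:R * flat k.+1 0 + 1 * flat k.+2 0 = 0.
    by rewrite /flat ltxx !mulr0 addr0.
  suff : (fun h => h^-1 *: ((flat k \o shift 0) (h *: 1) - flat k 0)) @ 0^' --> 0.
    by move=> cv; apply: DeriveDef; [apply/cvg_ex; exists 0|apply/cvg_lim].
  have -> : flat k 0 = 0 by rewrite /flat ltxx.
  apply/cvgrPdist_le => /= e e0.
  (* By [flat_le] the difference quotient at [h] is at most [(k+2)! |h|] in absolute value. *)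
  have r0 : 0 < e / k.+2`!%:R by rewrite divr_gt0 // ltr0n fact_gt0.
  near=> h.
  have h0 : h != 0 by near: h; exact: nbhs_dnbhs_neq.
  rewrite sub0r normrN subr0 addr0 [h *: 1]mulr1 normrM normfV.
  rewrite ler_pdivrMl ?normr_gt0 // (le_trans (flat_le _ _)) //.
  rewrite expr2 mulrCA ler_pM2l ?normr_gt0 // mulrC -ler_pdivlMr ?ltr0n ?fact_gt0 //.
  by near: h; exact: dnbhs0_le.
Unshelve. all: by end_near. Qed.

Lemma flat0_gt0 (t : R) : 0 < t -> 0 < flat 0 t.
Proof. by move=> t0; rewrite /flat t0 mul1r expR_gt0. Qed.

Lemma flat0_eq0 (t : R) : t <= 0 -> flat 0 t = 0.
Proof. by move=> t0; rewrite /flat ltNge t0. Qed.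

Lemma flat0_ge0 (t : R) : 0 <= flat 0 t.
Proof. by case: (leP t 0) => [/flat0_eq0->|/flat0_gt0/ltW]. Qed.

Lemma smooth_on_flat n (U : set 'rV[R]_n) (f : 'rV[R]_n -> R) k :
  open U -> smooth_on U f -> smooth_on U (flat k \o f).
Proof.
move=> oU fU; apply: (@smooth_on_tower _ _ U f flat (fun k => - k%:R) (fun=> 1) setT) => //.
by move=> j t _; exact: is_derive_flat.
Qed.

End OneVariable.

(** * Mean value estimates and Hadamard's lemma *)

Section MeanValue.
Context {R : realType}.

Lemma mean_value_abs (f df : R -> R) (t : R) :
  (forall x : R, is_derive x 1 f (df x)) ->
  exists2 c, `|c| <= `|t| & f t - f 0 = df c * t.
Proof.
move=> dfE.
have cf a b : {within `[a, b], continuous f}.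
  by apply: derivable_within_continuous => x _; exact: ex_derive.
have [t0|t0|->] := ltgtP t 0.
- have [c /[!in_itv] /= /andP[tc c0] E] := MVT t0 (fun x _ => dfE x) (cf _ _).
  exists c; first by rewrite !ltr0_norm // lerN2 ltW.
  by rewrite -opprB E sub0r mulrN opprK.
- have [c /[!in_itv] /= /andP[c0 ct] E] := MVT t0 (fun x _ => dfE x) (cf _ _).
  exists c; first by rewrite !gtr0_norm // ltW.
  by rewrite E subr0.
- by exists 0; rewrite // subrr mulr0.
Qed.

Lemma is_derive_line n (F : 'rV[R]_n -> R) x v (t : R) :
  differentiable F (x + t *: v) ->
  is_derive t 1 (fun s : R => F (x + s *: v)) ('D_v F (x + t *: v)).
Proof.
move=> dF; have := @diff_derivable _ _ _ _ _ v dF.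
rewrite /derivable => cF; suff E :
    (fun h : R => h^-1 *:
      (((fun s : R => F (x + s *: v)) \o shift t) (h *: 1) - F (x + t *: v))) =
    (fun h => h^-1 *: ((F \o shift (x + t *: v)) (h *: v) - F (x + t *: v))).
  by apply: DeriveDef; rewrite /derivable /derive E.
apply/funext => h /=; congr (_ *: (F _ - _)).
by rewrite [h *: 1]mulr1 scalerDl addrCA.
Qed.

(** The mean value theorem along [v], for the difference of [F] under translation by [t *: w], is
    followed by the mean value theorem along [w] for the derivative in direction [v]. *)
Lemma second_difference n (F : 'rV[R]_n -> R) x v w (t : R) :
  smooth_on setT F ->
  exists c d, [/\ `|c| <= `|t|, `|d| <= `|t| &
    F (x + t *: v + t *: w) - F (x + t *: v) - F (x + t *: w) + F x =
    'D_w (fun y => 'D_v F y) (x + c *: v + d *: w) * t ^+ 2].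
Proof.
move=> sF; have dF y : differentiable F y by apply: smooth_on_diff sF _.
have sDF := smooth_on_derive v sF.
have [c ct Ec] := @mean_value_abs (fun s : R => F (x + t *: w + s *: v) - F (x + s *: v))
  (fun s => 'D_v F (x + t *: w + s *: v) - 'D_v F (x + s *: v)) t
  (fun s => is_deriveB (is_derive_line (dF _)) (is_derive_line (dF _))).
have [d dt Ed] := @mean_value_abs _ _ t
  (fun s => @is_derive_line _ _ (x + c *: v) w s (smooth_on_diff sDF I)).
exists c, d; split=> //.
rewrite expr2 mulrA -Ed !scale0r !addr0 (addrAC x (c *: v)) -Ec !scale0r !addr0.
by rewrite (addrAC x (t *: w)); ring.
Qed.

(** The second difference is symmetric in [v] and [w]. Divided by [t^2], it is therefore a value of
    either mixed derivative at some point close to [x], and continuity excludes different values at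
    [x]. *)
Lemma derive_commute n (F : 'rV[R]_n -> R) x v w : smooth_on setT F ->
  'D_v (fun y => 'D_w F y) x = 'D_w (fun y => 'D_v F y) x.
Proof.
move=> sF; pose A := fun y => 'D_w (fun y => 'D_v F y) y.
pose B := fun y => 'D_v (fun y => 'D_w F y) y.
have cA : {for x, continuous A}.
  apply: differentiable_continuous; apply: (@smooth_on_diff _ _ setT) => //.
  by apply: smooth_on_derive; exact: smooth_on_derive.
have cB : {for x, continuous B}.
  apply: differentiable_continuous; apply: (@smooth_on_diff _ _ setT) => //.
  by apply: smooth_on_derive; exact: smooth_on_derive.
apply/eqP; rewrite -/(A x) -/(B x); apply/negPn/negP => AB.
pose e := `|B x - A x| / 2.
have e0 : 0 < e by rewrite divr_gt0 // normr_gt0 subr_eq0.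
have /nbhs_normP[r /= r0 rP] : \forall y \near x, `|A x - A y| < e /\ `|B x - B y| < e.
  by apply: filterI; [move/cvgrPdist_lt : cA|move/cvgrPdist_lt : cB]; apply.
(* Keeps every [x + c *: v + d *: w] with [c] and [d] bounded by [t] within distance [r] of [x]. *)
pose t := r / (`|v| + `|w| + 1).
have q0 : 0 < `|v| + `|w| + 1 by rewrite ltr_wpDl // addr_ge0.
have t0 : 0 < t by rewrite divr_gt0.
have tP c d : `|c| <= `|t| -> `|d| <= `|t| ->
    `|A x - A (x + c *: v + d *: w)| < e /\ `|B x - B (x + c *: v + d *: w)| < e.
  move=> ct dt; apply: rP => /=; rewrite /ball_ /=.
  rewrite -addrA opprD addrA subrr sub0r normrN.
  apply: (le_lt_trans (ler_normD _ _)); rewrite !normrZ.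
  apply: (@le_lt_trans _ _ (t * (`|v| + `|w|))).
    by rewrite mulrDr lerD // ler_wpM2r // -(gtr0_norm t0).
  by rewrite /t mulrAC ltr_pdivrMr // ltr_pM2l // ltrDl.
have [c [d [ct dt E]]] := second_difference x v w t sF.
have [c' [d' [ct' dt' E']]] := second_difference x w v t sF.
have {E E'} E : A (x + c *: v + d *: w) = B (x + d' *: v + c' *: w).
  apply: (@mulIf _ (t ^+ 2)); first by rewrite expf_neq0 // gt_eqF.
  rewrite (addrAC x (d' *: v)); apply: etrans (esym E) _; apply: etrans _ E'.
  by rewrite (addrAC x (t *: w)); ring.
have [+ _] := tP _ _ ct dt; have [_] := tP _ _ dt' ct'.
rewrite E; set z := B (x + d' *: v + c' *: w) => hB hA.
have : `|B x - A x| < e + e.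
  rewrite (_ : B x - A x = (B x - z) - (A x - z)); last by ring.
  exact: le_lt_trans (ler_normB _ _) (ltrD hB hA).
by rewrite -splitr ltxx.
Qed.

Lemma is_diff_small (V W : normedModType R) (r : V -> W) (x : V) : r x = 0 ->
  (forall e, 0 < e -> \forall y \near x, `|r y| <= e * `|y - x|) ->
  is_diff x r (fun=> 0).
Proof.
move=> rx small.
(* The zero map, taken as the differential of a constant so that it comes bundled as a linear
   map. *)
pose z : {linear V -> W} := 'd (cst (0 : W)) x.
have z0 : (z : _ -> _) = fun=> 0 by rewrite /z diff_cst.
have cz : continuous (z : V -> W) by rewrite z0; exact: cst_continuous.
have E : r \o shift x = cst (r x) + z +o_ 0 id.
  apply/eqaddoP => e e0; have := small e e0; rewrite (near_shift 0) /=.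
  apply: filterS => y; rewrite subr0 /= !fctE /= rx !add0r ?subr0 addrK.
  by rewrite z0 subr0.
have dE := diff_unique cz E.
apply: DiffDef; last by rewrite dE.
by apply/diff_locallyP; rewrite dE.
Qed.

End MeanValue.

Section RowNorm.
Context {R : realType} {n : nat}.
Implicit Types x : 'rV[R]_n.

Lemma norm_coord_le x i : `|x ord0 i| <= `|x|.
Proof.
rewrite [leRHS]/Num.Def.normr /= mx_normrE.
by rewrite (le_trans _ (le_bigmax _ _ (ord0, i))).
Qed.

Lemma norm_row_le x e : 0 <= e -> (forall i, `|x ord0 i| <= e) -> `|x| <= e.
Proof.
move=> e0 xe; rewrite [leLHS]/Num.Def.normr /= mx_normrE.
by apply: bigmax_le => // -[i k] _ /=; rewrite ord1.
Qed.

End RowNorm.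

(** * Smooth division by a coordinate *)

Section Hadamard.
Context {R : realType} {n : nat} (j : 'I_n).
Local Notation V := 'rV[R]_n.
Local Notation delta := (delta_mx ord0 j : V).
Local Notation X := (fun y : V => y ord0 j).
Implicit Types (F H : V -> R) (v : V).

Definition drop_coord (y : V) : V := y - y ord0 j *: delta.

Lemma drop_coord_j y : drop_coord y ord0 j = 0.
Proof. by rewrite /drop_coord !mxE !eqxx mulr1 subrr. Qed.

Lemma drop_coordK y : drop_coord y + y ord0 j *: delta = y.
Proof. by rewrite subrK. Qed.

Lemma drop_coord_id (y : V) : y ord0 j = 0 -> drop_coord y = y.
Proof. by move=> y0; rewrite /drop_coord y0 scale0r subr0. Qed.

Lemma differentiable_drop_coord y : differentiable drop_coord y.
Proof.
apply: differentiableB => //; apply: differentiableZl; exact: differentiable_coord.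
Qed.

Lemma derive_drop_coord y v : 'D_v drop_coord y = drop_coord v.
Proof.
have dX : differentiable X y by exact: differentiable_coord.
rewrite deriveB //; last exact/diff_derivable/differentiableZl.
rewrite derive_id deriveE; last exact: differentiableZl.
by rewrite diffZl //= -deriveE // derive_coord.
Qed.

Definition dj k F := iter_derive (nseq k delta) F.

Lemma smooth_dj k F : smooth_on setT F -> smooth_on setT (dj k F).
Proof. by elim: k F => [//|k IH] F sF; apply: IH; exact: smooth_on_derive. Qed.

Lemma djSr k F : dj k.+1 F = fun y => 'D_delta (dj k F) y.
Proof. by elim: k F => [//|k IH] F; rewrite [LHS]/= -[LHS]/(dj k.+1 _) IH. Qed.

Lemma djD k F H : smooth_on setT F -> smooth_on setT H ->
  dj k (F + H) = dj k F + dj k H.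
Proof.
elim: k F H => [//|k IH] F H sF sH; rewrite /dj /=.
rewrite -[RHS]/(dj k _ + dj k _) -IH; [|exact: smooth_on_derive..].
congr (iter_derive _ _); apply/funext => y.
by rewrite deriveD //; apply/diff_derivable/(@smooth_on_diff _ _ setT).
Qed.

Lemma djZ k (a : R) F : smooth_on setT F -> dj k (cst a * F) = cst a * dj k F.
Proof.
elim: k F => [//|k IH] F sF; rewrite /dj /=.
rewrite -[RHS]/(_ * dj k _) -IH; last exact: smooth_on_derive.
congr (iter_derive _ _); apply/funext => y.
rewrite deriveM //; last by apply/diff_derivable/(@smooth_on_diff _ _ setT).
by rewrite derive_cst scaler0 addr0.
Qed.

Lemma smooth_X : smooth_on setT X.
Proof. by apply: smooth_on_coord; exact: openT. Qed.

(** Leibniz rule in which only the first derivative of [X] survives. At [k = 0] the value of [k.-1]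
    is harmless, its coefficient being 0. *)
Lemma dj_mulX k F : smooth_on setT F ->
  dj k (X * F) = X * dj k F + cst k%:R * dj k.-1 F.
Proof.
elim: k F => [|k IH] F sF.
  by apply/funext => y; rewrite !fctE mul0r addr0.
have sDF := smooth_on_derive delta sF.
rewrite {1}/dj /= (_ : (fun y => 'D_delta (X * F) y) = X * (fun y => 'D_delta F y) + F).
  rewrite -/(dj k _) djD ?IH //; last first.
    by apply: smooth_onM => //; [exact: openT|exact: smooth_X].
  apply/funext => y; rewrite !fctE -addrA; congr (_ + _).
  case: k {IH} => [|k]; first by rewrite mul0r add0r mul1r.
  by rewrite (mulrSr 1 k.+1) mulrDl mul1r.
apply/funext => y; rewrite deriveM ?derive_coord.
- by rewrite !mxE !eqxx [F y *: 1]mulr1.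
- by apply/diff_derivable/differentiable_coord.
- by apply/diff_derivable/(@smooth_on_diff _ _ setT).
Qed.

Lemma dj_derive k F v : smooth_on setT F ->
  dj k (fun y => 'D_v F y) = fun y => 'D_v (dj k F) y.
Proof.
elim: k F => [//|k IH] F sF.
transitivity (dj k (fun y => 'D_v (fun z => 'D_delta F z) y)).
  by apply: (congr1 (dj k)); apply/funext => y; exact: derive_commute.
exact: (IH _ (smooth_on_derive delta sF)).
Qed.

Definition vanishing k F := forall a (y : V), (a < k)%N -> y ord0 j = 0 -> dj a F y = 0.

(** Taylor's formula along the [j]-th axis; the terms of order below [k] are killed by [vanishing].
    The induction applies the mean value theorem to [F] minus its two Taylor monomials. [B] is free
    so that the derivative at a fixed nearby centre can replace the one at [y]. *)
Lemma taylor_estimate k F e B (y : V) t : smooth_on setT F -> vanishing k F ->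
  y ord0 j = 0 -> 0 <= e ->
  (forall s, `|s| <= `|t| -> `|dj k.+1 F (y + s *: delta) - B| <= e) ->
  `|F (y + t *: delta) - dj k F y * (t ^+ k / k`!%:R) -
    B * (t ^+ k.+1 / k.+1`!%:R)| <= e * `|t| ^+ k.+1.
Proof.
elim: k F t => [|k IH] F t sF vF y0 e0 tB.
  have [c ct] := @mean_value_abs _ (fun s : R => F (y + s *: delta)) _ t
    (fun s => is_derive_line (@smooth_on_diff _ _ setT F _ sF I)).
  rewrite scale0r addr0 => E.
  rewrite expr0 fact0 divr1 mulr1 expr1 divr1 E -mulrBl normrM.
  by rewrite ler_wpM2r //; exact: tB.
have sDF := smooth_on_derive delta sF.
have fE m : (m.+1`!%:R : R) = m.+1%:R * m`!%:R by rewrite factS natrM.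
have f0 m : (m`!%:R : R) != 0 by rewrite pnatr_eq0 -lt0n fact_gt0.
have dmon m (C s : R) : is_derive s 1 (fun s : R => C * (s ^+ m.+1 / m.+1`!%:R))
    (C * (s ^+ m / m`!%:R)).
  have := is_deriveZ (C / m.+1`!%:R) (is_deriveX m.+1 (is_derive_id s 1)).
  set h := (X in is_derive _ _ X _).
  rewrite (_ : h = (fun s : R => C * (s ^+ m.+1 / m.+1`!%:R))); last first.
    by apply/funext => z; rewrite /h !fctE -[LHS]/(_ * _) mulrAC mulrA.
  move=> d; apply: is_derive_eq d _; rewrite /GRing.scale /= mulr1 fE.
  have q0 : (m.+1%:R : R) != 0 by rewrite pnatr_eq0.
  by move: (m.+1%:R : R) (m`!%:R : R) q0 (f0 m) => q f qn fn; field; rewrite qn fn.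
have [c ct] := @mean_value_abs _ _ _ t (fun s => is_deriveB (is_deriveB
    (is_derive_line (@smooth_on_diff _ _ setT F (y + s *: delta) sF I))
    (dmon k (dj k.+1 F y) s)) (dmon k.+1 B s)).
rewrite !fctE scale0r addr0 !expr0n /= !mul0r !mulr0 !subr0.
have -> : F y = 0 by exact: (vF 0%N).
rewrite subr0 => ->. rewrite normrM (exprSr `|t|) (mulrA e) ler_wpM2r //.
have := IH (fun y => 'D_delta F y) c sDF _ y0 e0 _.
move=> /(_ _ _)/le_trans; apply.
- by move=> a z ak z0; exact: (vF a.+1).
- by move=> s sc; apply: tB; exact: le_trans ct.
- by rewrite ler_wpM2l // lerXn2r // nnegrE.
Qed.

(* The smooth extension of [F / x_j ^ k] across the hyperplane [x_j = 0], for [F]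
   vanishing there to order [k]. Its derivative along [v] is the quotient of
   order [k.+1] of [quo_next k v F], so that these quotients form a class closed
   under differentiation, and each of them only has to be differentiable. *)
Definition quo k F (y : V) : R :=
  if y ord0 j == 0 then dj k F y / k`!%:R else F y / y ord0 j ^+ k.

(** By the Taylor estimate [quo k F] differs from [main] near [x] by [o(y_j)], so its differential
    is that of [main]. *)
Lemma quo_on_plane k F (x : V) : smooth_on setT F -> vanishing k F -> x ord0 j = 0 ->
  differentiable (quo k F) x /\ forall v, 'D_v (quo k F) x =
    'D_(drop_coord v) (dj k F) x / k`!%:R + v ord0 j * dj k.+1 F x / k.+1`!%:R.
Proof.
move=> sF vF x0; pose B := dj k.+1 F x.
have sk := smooth_dj k sF.
pose main := (dj k F \o drop_coord) * cst (k`!%:R^-1) + X * cst (B / k.+1`!%:R).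
have dk : differentiable (dj k F) (drop_coord x) by exact: smooth_on_diff sk _.
have d1 : differentiable (dj k F \o drop_coord) x.
  exact: differentiable_comp (differentiable_drop_coord x) dk.
have dX : differentiable X x by exact: differentiable_coord.
have d1c : differentiable ((dj k F \o drop_coord) * cst (k`!%:R^-1)) x.
  exact: differentiableM.
have dXc : differentiable (X * cst (B / k.+1`!%:R)) x by exact: differentiableM.
have dm : differentiable main x by exact: differentiableD.
have Dm v : 'D_v main x = 'D_(drop_coord v) (dj k F) x / k`!%:R +
    v ord0 j * B / k.+1`!%:R.
  rewrite /main deriveD; [|exact: diff_derivable..].
  rewrite !deriveM; [|exact: diff_derivable..|exact: diff_derivable].
  rewrite !derive_cst !scaler0 !add0r derive_coord.
  have -> : 'D_v (dj k F \o drop_coord) x = 'D_(drop_coord v) (dj k F) x.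
    rewrite (deriveE _ d1) (diff_comp (differentiable_drop_coord x) dk) /=.
    rewrite -(deriveE _ (differentiable_drop_coord x)) derive_drop_coord.
    by rewrite -(deriveE _ dk) drop_coord_id.
  rewrite /cst /GRing.scale /= mulrC; congr (_ + _); ring.
pose r := quo k F - main.
have f0 m : 0 < (m`!%:R : R) by rewrite ltr0n fact_gt0.
have rx : r x = 0.
  rewrite /r /main !fctE /quo x0 eqxx drop_coord_id // mul0r addr0 /=.
  by rewrite subrr.
have [dr Dr] : is_diff x r (fun=> 0).
  apply: is_diff_small => // e e0.
  have cB : {for x, continuous (dj k.+1 F)}.
    by apply: differentiable_continuous; apply: smooth_on_diff (smooth_dj k.+1 sF) _.
  have /nbhs_normP[d /= d0 dP] : \forall y \near x, `|dj k.+1 F x - dj k.+1 F y| < e.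
    by move/cvgrPdist_lt : cB; apply.
  apply/nbhs_normP; exists d => //.
  move=> y /= yx; rewrite distrC in yx.
  have ty : `|y ord0 j| <= `|y - x|.
    by have := norm_coord_le (y - x) j; rewrite !mxE x0 subr0.
  have /= te := @taylor_estimate k F e B (drop_coord y) (y ord0 j) sF vF
    (drop_coord_j y) (ltW e0) _.
  have {}te : `|F y - dj k F (drop_coord y) * (y ord0 j ^+ k / k`!%:R) -
      B * (y ord0 j ^+ k.+1 / k.+1`!%:R)| <= e * `|y ord0 j| ^+ k.+1.
    rewrite drop_coordK in te; apply: te => s st.
    (* The point at height [s] over [drop_coord y] is no farther from [x] than [y] is: the norm is
       the maximum of the coordinates, and [s] is bounded by the [j]-th coordinate of [y]. *)
    rewrite distrC ltW //; apply: dP; rewrite /ball_ /=.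
    apply: le_lt_trans yx; apply: norm_row_le => // i.
    rewrite /drop_coord !mxE eqxx /=; have [->|ij] := eqVneq i j.
      by rewrite x0 !mulr1 subrr !add0r normrN (le_trans st).
    rewrite !mulr0 subr0 addr0.
    by rewrite (distrC (x ord0 i)); have := norm_coord_le (y - x) i; rewrite !mxE.
  apply: (@le_trans _ _ (e * `|y ord0 j|)); last by rewrite ler_wpM2l // ltW.
  rewrite /r /main !fctE /quo; case: eqP => [y0|/eqP y0].
    by rewrite y0 drop_coord_id // mul0r addr0 subrr normr0 mulr0.
  (* Off the plane, multiplying by the [k]-th power of the height turns the claim into the Taylor
     estimate. *)
  have yk : 0 < `|y ord0 j| ^+ k by rewrite exprn_gt0 // normr_gt0.
  rewrite -(ler_pM2r yk) -mulrA -exprS -[X in _ * X <= _]normrX -normrM.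
  apply: le_trans te; rewrite le_eqVlt; apply/orP; left; apply/eqP; congr (`|_|).
  rewrite /= exprS; field.
  by rewrite expf_neq0 // !gt_eqF.
rewrite (_ : quo k F = main + r); last by apply/funext => y; rewrite /r !fctE addrC subrK.
split; first exact: differentiableD.
move=> v; rewrite deriveD; [|exact: diff_derivable..].
by rewrite (deriveE _ dr) Dr addr0 Dm.
Qed.

(** The numerator that the quotient rule gives for [F / x_j^k] over the denominator [x_j^(k+1)]. *)
Definition quo_next k v F : V -> R :=
  X * (fun y => 'D_v F y) + cst (- (k%:R * v ord0 j)) * F.

Lemma smooth_quo_next k v F : smooth_on setT F -> smooth_on setT (quo_next k v F).
Proof.
move=> sF; apply: smooth_onD; [exact: openT| |].
- by apply: smooth_onM; [exact: openT|exact: smooth_X|exact: smooth_on_derive].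
- by apply: smooth_onM; [exact: openT|exact: smooth_on_cst|].
Qed.

Lemma dj_quo_next a k v F y : smooth_on setT F -> dj a (quo_next k v F) y =
  y ord0 j * dj a (fun y => 'D_v F y) y + a%:R * 'D_v (dj a.-1 F) y -
  k%:R * v ord0 j * dj a F y.
Proof.
move=> sF; have sDF := smooth_on_derive v sF.
rewrite /quo_next djD ?djZ ?dj_mulX //.
- by rewrite !fctE mulNr; congr (_ + _ * _ - _); rewrite dj_derive.
- by apply: smooth_onM; [exact: openT|exact: smooth_X|].
- by apply: smooth_onM; [exact: openT|exact: smooth_on_cst|].
Qed.

Lemma derive_split F (y : V) v : differentiable F y ->
  'D_v F y = 'D_(drop_coord v) F y + v ord0 j * 'D_delta F y.
Proof.
by move=> dF; rewrite !(deriveE _ dF) -{1}(drop_coordK v) linearD linearZ.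
Qed.

Lemma derive_tangent F (y : V) v : (forall z : V, z ord0 j = 0 -> F z = 0) ->
  y ord0 j = 0 -> v ord0 j = 0 -> 'D_v F y = 0.
Proof.
move=> F0 y0 v0; apply/cvg_lim => //; apply: cvg_near_cst; apply: nearW => h.
by rewrite /= !F0 ?subrr ?scaler0 // !mxE y0 v0 mulr0 addr0.
Qed.

(** On the plane the tangential derivatives of [dj a F] vanish for [a < k], so the derivative of
    order [a + 1] of [quo_next k v F] is [(a + 1 - k) v_j dj (a + 1) F]. Either the first factor is
    0 or [a + 1 < k]. *)
Lemma vanishing_next k v F : smooth_on setT F -> vanishing k F ->
  vanishing k.+1 (quo_next k v F).
Proof.
move=> sF vF a y ak y0; rewrite dj_quo_next // y0 mul0r add0r.
case: a ak => [_|a ak].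
  rewrite mul0r add0r; case: k vF => [|k] vF; first by rewrite !mul0r oppr0.
  by rewrite (vF 0%N) // mulr0 oppr0.
have -> : 'D_v (dj a F) y = v ord0 j * dj a.+1 F y.
  rewrite derive_split; last exact: smooth_on_diff (smooth_dj a sF) _.
  rewrite (derive_tangent _ y0 (drop_coord_j v)) ?add0r ?djSr // => z z0.
  exact: vF.
move: ak; rewrite ltnS leq_eqVlt => /predU1P[->|ak]; first by ring.
by rewrite (vF a.+1) // !mulr0 subr0.
Qed.

Lemma quo_off_plane k F (y : V) : smooth_on setT F -> y ord0 j != 0 ->
  differentiable (quo k F) y /\
  forall v, 'D_v (quo k F) y = quo k.+1 (quo_next k v F) y.
Proof.
move=> sF y0; pose G : V -> R := F * (fun z => (z ord0 j ^+ k)^-1).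
have dX : differentiable X y by exact: differentiable_coord.
have dF : differentiable F y by exact: smooth_on_diff sF _.
have dXk : differentiable (X ^+ k) y.
  case: (k) => [|m]; last exact: differentiableX.
  by rewrite expr0; exact: differentiable_cst.
have yk : (X ^+ k) y != 0 by rewrite fctE expf_neq0.
have XE : (fun z : V => (z ord0 j ^+ k)^-1) = (fun z => ((X ^+ k) z)^-1).
  by apply/funext => z; rewrite fctE.
have dV : differentiable (fun z : V => (z ord0 j ^+ k)^-1) y.
  by rewrite XE; exact: differentiableV.
have GE : {near y, G =1 quo k F}.
  have cX : {for y, continuous X} by exact: differentiable_continuous.
  have nz : \forall z \near y, X z != 0.
    have := cX [set t | t != 0]; apply; apply: open_nbhs_nbhs.
    by split => //; exact: open_neq.
  by apply: filterS nz => z z0; rewrite /quo (negbTE z0).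
split; first by apply: near_eq_differentiable GE _; exact: differentiableM.
move=> v; rewrite -(near_eq_derive _ GE) deriveM; [|exact: diff_derivable..].
rewrite XE deriveV //; last exact: diff_derivable.
rewrite deriveX; last exact: diff_derivable.
rewrite derive_coord /quo (negbTE y0) /quo_next !fctE /GRing.scale /=.
case: k {G dXk yk XE dV GE} => [|k]; rewrite !exprS ?expr0; field.
  by [].
by rewrite expf_neq0.
Qed.

Lemma quo_derive k F (y : V) : smooth_on setT F -> vanishing k F ->
  differentiable (quo k F) y /\
  forall v, 'D_v (quo k F) y = quo k.+1 (quo_next k v F) y.
Proof.
move=> sF vF; have [y0|y0] := eqVneq (y ord0 j) 0; last exact: quo_off_plane.
have [dq Dq] := quo_on_plane sF vF y0; split=> // v.
rewrite Dq /quo y0 eqxx dj_quo_next // y0 mul0r add0r /=.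
rewrite (derive_split v); last exact: smooth_on_diff (smooth_dj k sF) _.
have -> : 'D_delta (dj k F) y = dj k.+1 F y by rewrite djSr.
rewrite factS natrM.
have q0 : (k.+1%:R : R) != 0 by rewrite pnatr_eq0.
have f0 : (k`!%:R : R) != 0 by rewrite pnatr_eq0 -lt0n fact_gt0.
rewrite (mulrS 1 k) in q0 *.
by move: (k%:R : R) (k`!%:R : R) q0 f0 => q f q0 f0; field; rewrite f0 q0.
Qed.

Lemma smooth_quo k F : smooth_on setT F -> vanishing k F ->
  smooth_on setT (quo k F).
Proof.
move=> sF vF.
apply: (@generated_smooth_on _ _ setT [set f | exists m H,
  [/\ smooth_on setT H, vanishing m H & f = quo m H]]).
- exact: openT.
- by move=> _ y [m [H [sH vH ->]]] _; have [] := quo_derive y sH vH.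
- move=> _ v [m [H [sH vH ->]]]; apply: gen_base.
  exists m.+1, (quo_next m v H); split; [exact: smooth_quo_next|exact: vanishing_next|].
  by apply/funext => y; have [_ ->] := quo_derive y sH vH.
- by apply: gen_base; exists k, F.
Qed.

Lemma smooth_divides F : smooth_on setT F ->
  (forall y : V, y ord0 j = 0 -> F y = 0) ->
  exists2 Q, smooth_on setT Q & F = X * Q.
Proof.
move=> sF F0; have v1 : vanishing 1 F by case=> // y _; exact: F0.
exists (quo 1 F); first exact: smooth_quo.
apply/funext => y; rewrite fctE /quo; case: eqP => [y0|/eqP y0].
  by rewrite y0 mul0r F0.
by rewrite expr1 mulrC divfK.
Qed.

End Hadamard.

(** The customary factors are integrals of partial derivatives. Here they are quotients by a
    coordinate, which avoids differentiating under an integral sign; differentiating the expansion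
    at [x] identifies [h i x]. *)
Lemma hadamard_lemma (R : realType) n (F : 'rV[R]_n -> R) (x : 'rV[R]_n) :
  smooth_on setT F -> exists h : 'I_n -> 'rV[R]_n -> R,
  [/\ forall i, smooth_on setT (h i),
   forall i, h i x = 'D_(delta_mx ord0 i) F x &
   forall y, F y = F x + \sum_i (y ord0 i - x ord0 i) * h i y].
Proof.
move=> sF.
(* Telescope along [P], which moves the coordinates of [y] to those of [x]. *)
pose P (k : nat) (y : 'rV[R]_n) : 'rV[R]_n :=
  \row_l (if (l < k)%N then x ord0 l else y ord0 l + x ord0 l).
have sFP k : smooth_on setT (F \o P k).
  apply: (@smooth_on_comp _ _ _ setT setT) => //; first exact: openT.
  move=> l; apply: (@smooth_on_eq _ _ _ (if (l < k)%N then cst (x ord0 l) else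
     (fun y : 'rV[R]_n => y ord0 l) + cst (x ord0 l))); first exact: openT.
    by move=> y _; rewrite mxE; case: ifP.
  case: ifP => _; first exact: smooth_on_cst.
  exact: smooth_on_coordD.
have /fin_all_exists2[Q sQ QE] (i : 'I_n) : exists2 Q, smooth_on setT Q &
    (F \o P i) - (F \o P i.+1) = (fun y : 'rV[R]_n => y ord0 i) * Q.
  apply: smooth_divides => [|y y0].
    apply: smooth_onD (openT) (sFP i) _.
    rewrite (_ : - _ = cst (-1) * (F \o P i.+1)); last first.
      by apply/funext => y; rewrite !fctE mulN1r.
    by apply: smooth_onM; [exact: openT|exact: smooth_on_cst|].
  rewrite !fctE /=; suff -> : P i y = P i.+1 y by rewrite subrr.
  apply/rowP => l; rewrite !mxE [in RHS]ltnS [in RHS]leq_eqVlt.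
  have [->|li] := eqVneq l i; first by rewrite ltnn eqxx y0 add0r.
  by rewrite (inj_eq val_inj) (negbTE li).
(* [P] takes the displacement [y - x] as its argument, so that the [i]-th increment vanishes on the
   coordinate hyperplane through the origin, as [smooth_divides] requires. *)
pose h i := Q i \o (fun y => y - x).
have FE y : F y = F x + \sum_i (y ord0 i - x ord0 i) * h i y.
  have -> : \sum_i (y ord0 i - x ord0 i) * h i y =
      \sum_(i < n) (F (P i (y - x)) - F (P i.+1 (y - x))).
    apply: eq_bigr => i _; have /(congr1 (@^~ (y - x))) := QE i.
    by rewrite !fctE /= !mxE => ->.
  rewrite -(big_mkord xpredT (fun i => F (P i (y - x)) - F (P i.+1 (y - x)))).
  under eq_bigr do rewrite -opprB.
  rewrite sumrN telescope_sumr // opprB.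
  have -> : P 0%N (y - x) = y by apply/rowP => l; rewrite !mxE /= subrK.
  suff -> : P n (y - x) = x by rewrite addrC subrK.
  by apply/rowP => l; rewrite !mxE ltn_ord.
have sh i : smooth_on setT (h i).
  apply: (@smooth_on_comp _ _ _ setT setT) (sQ i) => //; first exact: openT.
  move=> l; apply: (@smooth_on_eq _ _ _ ((fun y : 'rV[R]_n => y ord0 l) + cst (- x ord0 l))).
  - exact: openT.
  - by move=> y _; rewrite !mxE.
  - exact: smooth_on_coordD.
exists h; split=> // i; apply/esym.
have dcoord l : differentiable (fun y : 'rV[R]_n => y ord0 l) x.
  exact: differentiable_coord.
have dh l : differentiable (h l) x by exact: smooth_on_diff (sh l) _.
have dsub l : differentiable ((fun y : 'rV[R]_n => y ord0 l) - cst (x ord0 l)) x.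
  exact: differentiableB.
rewrite (_ : F = cst (F x) + \sum_l ((fun y : 'rV[R]_n => y ord0 l) - cst (x ord0 l)) * h l);
  last by apply/funext => y; rewrite {1}FE !fctE fct_sumE; congr (_ + _);
          apply: eq_bigr => l _; rewrite !fctE.
rewrite deriveD //; last first.
  by apply: diff_derivable; apply: differentiable_sum => l; exact: differentiableM.
rewrite derive_cst add0r derive_sum; last first.
  by move=> l; apply: diff_derivable; exact: differentiableM.
rewrite (bigD1 i) //= big1 ?addr0 => [|l li]; rewrite deriveM; do ?exact: diff_derivable.
- rewrite !fctE subrr scale0r add0r deriveB; do ?exact: diff_derivable.
  by rewrite derive_cst subr0 derive_coord !mxE !eqxx [LHS]mulr1.
- rewrite !fctE subrr scale0r add0r deriveB; do ?exact: diff_derivable.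
  by rewrite derive_cst subr0 derive_coord !mxE (negbTE li) andbF scaler0.
Qed.

(** * Charts and bump functions *)

Section EuclideanBump.
Context {R : realType} {n : nat}.
Implicit Types x y z : 'rV[R]_n.

Lemma smooth_at_eq x (f g : 'rV[R]_n -> R) :
  {near x, f =1 g} -> smooth_at x f -> smooth_at x g.
Proof. by move=> fg fx; apply: smooth_algP; apply: SAeq fg; exact: SAbase. Qed.

Lemma smooth_onT (f : 'rV[R]_n -> R) : (forall x, smooth_at x f) -> smooth_on setT f.
Proof. by move=> fx x _; exact: (nbhs_singleton (fx x)). Qed.

Lemma smooth_onT_at (f : 'rV[R]_n -> R) x : smooth_on setT f -> smooth_at x f.
Proof. by move=> sf; apply/smooth_atE; exists setT; split => //; exact: openT. Qed.

(** The norm of row vectors is the maximum of the coordinates and is not smooth; cut-offs and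
    touching balls use the squared Euclidean distance instead. *)
Definition sqdist x y : R := \sum_j (y ord0 j - x ord0 j) ^+ 2.

Lemma sqdist_ge0 x y : 0 <= sqdist x y.
Proof. by apply: sumr_ge0 => j _; exact: sqr_ge0. Qed.

Lemma sqdistxx x : sqdist x x = 0.
Proof. by apply: big1 => j _; rewrite subrr expr0n. Qed.

Lemma smooth_sqdist x : smooth_on setT (sqdist x).
Proof.
apply: smooth_on_sum => [|j _]; first exact: openT.
have sj : smooth_on setT ((fun y : 'rV[R]_n => y ord0 j) + cst (- x ord0 j)).
  exact: smooth_on_coordD.
by apply: smooth_on_eq (smooth_onM _ sj sj) => //; exact: openT.
Qed.

Lemma derive_sqdist (x y w : 'rV[R]_n) :
  'D_w (sqdist x) y = 2 * \sum_j (y ord0 j - x ord0 j) * w ord0 j.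
Proof.
pose X j : 'rV[R]_n -> R := (fun z => z ord0 j) - cst (x ord0 j).
have dX j : differentiable (X j) y.
  apply: differentiableB; first exact: differentiable_coord.
  exact: differentiable_cst.
rewrite (_ : sqdist x = \sum_j (X j * X j)); last first.
  by apply/funext => z; rewrite fct_sumE.
rewrite derive_sum; last first.
  by move=> j; apply: diff_derivable; apply: differentiableM; exact: dX.
rewrite mulr_sumr; apply: eq_bigr => j _.
have DX : 'D_w (X j) y = w ord0 j.
  rewrite deriveB; [|exact/diff_derivable/differentiable_coord|exact: derivable_cst].
  by rewrite derive_coord derive_cst subr0.
rewrite deriveM; [|exact/diff_derivable/dX..].
by rewrite DX /X !fctE /GRing.scale /=; ring.
Qed.

Lemma sqdistC (x y : 'rV[R]_n) : sqdist x y = sqdist y x.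
Proof. by apply: eq_bigr => j _; rewrite -sqrrN opprB. Qed.

Lemma norm_le_sqdist x y r : 0 <= r -> sqdist x y <= r ^+ 2 -> `|y - x| <= r.
Proof.
move=> r0 xyr; apply: norm_row_le => // i; rewrite !mxE.
rewrite -(ger0_norm r0) -ler_sqr ?nnegrE // !real_normK ?num_real //.
apply: le_trans xyr; rewrite /sqdist (bigD1 i) //= lerDl.
by apply: sumr_ge0 => j _; exact: sqr_ge0.
Qed.

Lemma sqdist_eq0 (x y : 'rV[R]_n) : sqdist x y = 0 -> y = x.
Proof.
move=> h; have : `|y - x| <= 0 by apply: norm_le_sqdist; rewrite // h expr0n.
by rewrite normr_le0 subr_eq0 => /eqP.
Qed.

Lemma sqdist_triangle (x y z : 'rV[R]_n) :
  sqdist x z <= 2 * (sqdist x y + sqdist y z).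
Proof.
rewrite /sqdist -big_split mulr_sumr; apply: ler_sum => j _ /=.
by have := sqr_ge0 ((y ord0 j - x ord0 j) - (z ord0 j - y ord0 j)); lra.
Qed.

Lemma sqdist_near x e : 0 < e -> \forall y \near x, sqdist x y < e.
Proof.
move=> e0; have c : {for x, continuous (sqdist x)}.
  apply: differentiable_continuous; exact: smooth_on_diff (smooth_sqdist x) _.
have := c [set t | t < e]; apply; apply: open_nbhs_nbhs; split; first exact: open_lt.
by rewrite /= sqdistxx.
Qed.

Lemma closed_ball_compact_row x r : compact [set y | `|y - x| <= r].
Proof.
apply: bounded_closed_compact.
  exists (r + `|x|); split; first exact: num_real.
  move=> M rM y /= yx; rewrite -(subrK x y) (le_trans (ler_normD _ _)) //.
  by apply: ltW; apply: le_lt_trans rM; rewrite lerD2r.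
rewrite (_ : [set y | _] = closed_ball_ Num.norm x r); first exact: closed_closed_ball_.
by apply/seteqP; split => y; rewrite /closed_ball_ /= distrC.
Qed.

Lemma nbhs_closed_ball x (W : set 'rV[R]_n) : nbhs x W ->
  exists2 r, 0 < r & [set y | `|y - x| <= r] `<=` W.
Proof.
move=> /nbhs_normP[e /= e0 eW]; exists (e / 2); first by rewrite divr_gt0.
move=> y /= yx; apply: eW; rewrite /ball_ /= distrC (le_lt_trans yx) //.
by rewrite ltr_pdivrMr // ltr_pMr // ltr1n.
Qed.

(** With [s = r^2], [f1] is positive where [sqdist x] is below [s] and [f2] where it exceeds
    [s / 2]. Their sum is thus positive everywhere, and [f1 / (f1 + f2)] is 1 where [f2] vanishes
    and 0 where [f1] does. *)
Lemma euclidean_bump x r : 0 < r -> exists chi : 'rV[R]_n -> R,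
  [/\ smooth_on setT chi, \forall y \near x, chi y = 1 &
      forall y, r < `|y - x| -> chi y = 0].
Proof.
move=> r0; pose s := r ^+ 2; have s0 : 0 < s by rewrite exprn_gt0.
pose f1 : 'rV[R]_n -> R := flat 0 \o (cst s + cst (-1) * sqdist x).
pose f2 : 'rV[R]_n -> R := flat 0 \o (sqdist x + cst (- (s / 2))).
have oT := @openT 'rV[R]_n.
have c1 (a : R) : smooth_on (setT : set 'rV[R]_n) (cst a) by exact: smooth_on_cst.
have s1 : smooth_on setT f1.
  apply: smooth_on_flat => //; apply: smooth_onD => //; apply: smooth_onM => //.
  exact: smooth_sqdist.
have s2 : smooth_on setT f2.
  by apply: smooth_on_flat => //; apply: smooth_onD => //; exact: smooth_sqdist.
have f1E y : f1 y = flat 0 (s - sqdist x y) by rewrite /f1 /= !fctE mulN1r.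
have f2E y : f2 y = flat 0 (sqdist x y - s / 2) by [].
have f120 y : 0 < f1 y + f2 y.
  rewrite f1E f2E; have [h|h] := ltP (sqdist x y) s.
    by rewrite ltr_wpDr ?flat0_ge0 // flat0_gt0 // subr_gt0.
  rewrite ltr_wpDl ?flat0_ge0 // flat0_gt0 // subr_gt0 (lt_le_trans _ h) //.
  by rewrite ltr_pdivrMr // ltr_pMr // ltr1n.
exists (fun y => f1 y / (f1 y + f2 y)); split.
- apply: smooth_on_eq (smooth_onM oT s1 (smooth_on_inv oT (smooth_onD oT s1 s2) _)) => //.
  by move=> y _; exact: f120.
- have : \forall y \near x, sqdist x y < s / 2 by apply: sqdist_near; rewrite divr_gt0.
  apply: filterS => y ys; have f0 : f2 y = 0 by rewrite f2E flat0_eq0 // subr_le0 ltW.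
  by have := f120 y; rewrite f0 addr0 => h; rewrite divff // gt_eqF.
- move=> y ry; rewrite f1E flat0_eq0 ?mul0r // subr_le0 leNgt; apply/negP => ys.
  by move: ry; rewrite ltNge norm_le_sqdist // ltW.
Qed.

End EuclideanBump.

Section Charts.
Context {R : realType} {n : nat} {M : manifold R n}.
Implicit Types (p q : M) (c d : chart R n M) (f g : M -> R).

Lemma chart_dom_near c p : chart_dom c p -> \forall q \near p, chart_dom c q.
Proof.
by move=> cp; apply: open_nbhs_nbhs; split=> //; exact: chart_dom_open.
Qed.

Lemma chart_inv_id c p : chart_dom c p -> chart_inv c (c p) = p.
Proof. by move=> cp; apply: chart_funK; rewrite inE. Qed.

Lemma chart_cvg c p : chart_dom c p -> {for p, continuous c}.
Proof. by move=> cp; apply: chart_fun_continuous; rewrite inE. Qed.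

Lemma chart_inv_cvg c p : chart_dom c p -> {for c p, continuous (chart_inv c)}.
Proof. by move=> cp; apply: chart_inv_continuous; rewrite inE; exists p. Qed.

Lemma chart_img_near c p : chart_dom c p ->
  \forall x \near c p, chart_dom c (chart_inv c x) /\ c (chart_inv c x) = x.
Proof.
move=> cp; have : nbhs (c p) (c @` chart_dom c).
  by apply: open_nbhs_nbhs; split; [exact: chart_img_open|exists p].
by apply: filterS => _ [q cq <-]; rewrite chart_inv_id.
Qed.

Lemma near_chart_inv c p (P : M -> Prop) : chart_dom c p ->
  (\forall q \near p, P q) -> \forall x \near c p, P (chart_inv c x).
Proof.
by move=> cp Pp; apply: (@chart_inv_cvg c p cp P); rewrite chart_inv_id.
Qed.

Lemma near_chart c p (P : 'rV[R]_n -> Prop) : chart_dom c p ->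
  (\forall x \near c p, P x) -> \forall q \near p, P (c q).
Proof. by move=> /chart_cvg cp; exact: cp. Qed.

(** Any other chart differs by a transition map, smooth by [atlas_compat]. *)
Lemma msmooth_at_chart c p f : atlas M c -> chart_dom c p ->
  smooth_at (c p) (f \o chart_inv c) -> msmooth_at p f.
Proof.
move=> Mc cp sf d Md dp.
have E : {near d p, (f \o chart_inv c) \o (c \o chart_inv d) =1 f \o chart_inv d}.
  have := near_chart_inv dp (chart_dom_near cp).
  by apply: filterS => x cx; rewrite /= chart_inv_id.
apply: smooth_at_eq E _; apply: smooth_at_comp.
  by move=> j; exact: atlas_compat.
by rewrite /= chart_inv_id.
Qed.

Lemma msmooth_at_eq p f g : {near p, f =1 g} -> msmooth_at p f -> msmooth_at p g.
Proof.
move=> fg fp c Mc cp; apply: smooth_at_eq (fp c Mc cp).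
exact: near_chart_inv fg.
Qed.

Lemma msmooth_at_near p f : msmooth_at p f -> \forall q \near p, msmooth_at q f.
Proof.
move=> fp; have [c Mc cp] := atlas_cover p.
have /near_join/(near_chart cp) := fp c Mc cp.
have := chart_dom_near cp; apply: filterS2 => q cq fq.
exact: msmooth_at_chart fq.
Qed.

Lemma msmooth_at_continuous p f : msmooth_at p f -> {for p, continuous f}.
Proof.
move=> fp; have [c Mc cp] := atlas_cover p.
have df : differentiable (f \o chart_inv c) (c p) := nbhs_singleton (fp c Mc cp) [::].
have cf : {for p, continuous ((f \o chart_inv c) \o c)}.
  by apply: continuous_comp; [exact: chart_cvg|exact: differentiable_continuous].
have E : {near p, (f \o chart_inv c) \o c =1 f}.
  have := chart_dom_near cp.
  by apply: filterS => q cq; rewrite /= chart_inv_id.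
move: cf; rewrite /prop_for /continuous_at /= chart_inv_id //.
by apply: cvg_trans; exact: near_eq_cvg.
Qed.

Lemma smooth_fun_continuous (f : smooth_fun M) : continuous f.
Proof. by move=> p; apply: msmooth_at_continuous; exact: smooth_fun_at. Qed.

Lemma smooth_funE f : (forall p, msmooth_at p f) -> f \in @smooth R n M.
Proof. by move=> sf; apply/asboolP. Qed.

Lemma msmooth_at_comp_chart c p (F : 'rV[R]_n -> R) : atlas M c -> chart_dom c p ->
  smooth_at (c p) F -> msmooth_at p (F \o c).
Proof.
move=> Mc cp sF; apply: (msmooth_at_chart Mc cp); apply: smooth_at_eq sF.
have := chart_img_near cp.
by apply: filterS => x [_ E]; rewrite /= E.
Qed.

Lemma compact_chart_ball c p (r : R) :
  [set x | `|x - c p| <= r] `<=`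
    [set x | chart_dom c (chart_inv c x) /\ c (chart_inv c x) = x] ->
  compact (chart_inv c @` [set x : 'rV[R]_n | `|x - c p| <= r]).
Proof.
move=> rU; apply: continuous_compact; last exact: closed_ball_compact_row.
apply: continuous_in_subspaceT => x /[!inE] /rU[cx xE].
by rewrite -xE; exact: chart_inv_cvg.
Qed.

(** The dichotomy at every [q] is the form in which the support condition is used: it makes the
    product of [b] with a function smooth only on [U] globally smooth. *)
Lemma bump_exists p (U : set M) : nbhs p U -> exists b : smooth_fun M,
  (\forall q \near p, b q = 1) /\
  (forall q, nbhs q U \/ \forall q' \near q, b q' = 0).
Proof.
move=> pU; have [c Mc cp] := atlas_cover p.
have : \forall x \near c p, nbhs (chart_inv c x) U.
  apply: (@near_chart_inv c p (fun q => nbhs q U)) => //; exact: near_join pU.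
move/filterI => /(_ _ (chart_img_near cp))/nbhs_closed_ball[r r0 rU].
have [chi [schi chi1 chi0]] := euclidean_bump (c p) r0.
pose B := [set y | `|y - c p| <= r]; pose K := chart_inv c @` B.
pose b q := if `[< chart_dom c q >] then chi (c q) else 0.
(* The Hausdorff property enters here. With [K] closed, [b] vanishes on an open set around every
   point outside [K], which makes the extension by 0 smooth. *)
have clK : closed K.
  apply: compact_closed; first exact: mf_hausdorff.
  by apply: compact_chart_ball => x /rU[].
have bK q : ~ K q -> b q = 0.
  move=> nKq; rewrite /b; case: asboolP => // cq; apply: chi0.
  rewrite ltNge; apply/negP => qB; apply: nKq; exists (c q) => //.
  exact: chart_inv_id.
have bK' q : ~ K q -> \forall q' \near q, b q' = 0.
  move=> nKq; have : nbhs q (~` K).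
    by apply: open_nbhs_nbhs; split => //; exact: closed_openC.
  by apply: filterS => q' /bK.
have sb : b \in @smooth R n M.
  apply: smooth_funE => q; have [cq|ncq] := pselect (chart_dom c q).
    apply: (@msmooth_at_eq _ (chi \o c)).
      have := chart_dom_near cq.
      by apply: filterS => q' cq'; rewrite /b /= asboolT.
    apply: msmooth_at_comp_chart => //; exact: smooth_onT_at.
  apply: (@msmooth_at_eq _ (cst 0)); last exact: msmooth_at_cst.
  have : ~ K q by move=> [x /rU[_ [cx _]] xq]; rewrite xq in cx.
  by move=> /bK'; apply: filterS => q' ->.
exists (SmoothFun sb); split=> [|q] /=.
  have := chart_dom_near cp; have := near_chart cp chi1.
  by apply: filterS2 => q chiq cq; rewrite /b asboolT.
have [[x /rU[xU _] <-]|nKq] := pselect (K q); first by left.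
by right; exact: bK'.
Qed.

Lemma cutoff_smooth (b : smooth_fun M) (U : set M) f :
  (forall q, nbhs q U \/ \forall q' \near q, b q' = 0) ->
  (forall q, U q -> msmooth_at q f) ->
  (fun q => b q * f q) \in @smooth R n M.
Proof.
move=> bU fU; apply: smooth_funE => q; have [/nbhs_singleton/fU fq|b0] := bU q.
  by apply: msmooth_atM => //; exact: smooth_fun_at.
apply: (@msmooth_at_eq _ (cst 0)); last exact: msmooth_at_cst.
by apply: filterS b0 => q' ->; rewrite mul0r.
Qed.

(** Tangent vectors act on global functions only; this makes germs available to them. *)
Lemma smooth_extension p f : msmooth_at p f ->
  exists F : smooth_fun M, {near p, F =1 f}.
Proof.
move=> /msmooth_at_near fp; have [b [b1 bU]] := bump_exists fp.
exists (SmoothFun (cutoff_smooth bU (fun q fq => fq))).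
by apply: filterS b1 => q /= ->; rewrite mul1r.
Qed.

End Charts.

(** * Tangent vectors *)

Section TangentVectors.
Context {R : realType} {n : nat} {M : manifold R n}.
Implicit Types (p q : M) (c : chart R n M) (f h : smooth_fun M).

Lemma tangentD p (v : tangent p) f h : v (f + h) = v f + v h.
Proof.
have /asboolP[vl _] := tangentP v.
by rewrite -[f in LHS]scale1r vl mul1r.
Qed.

Lemma tangentM p (v : tangent p) f h : v (f * h) = f p * v h + h p * v f.
Proof. by have /asboolP[_ ->] := tangentP v. Qed.

Lemma tangent0 p (v : tangent p) : v 0 = 0.
Proof. by apply: (@addrI _ (v 0)); rewrite -tangentD !addr0. Qed.

Lemma tangentZ p (v : tangent p) (a : R) f : v (a *: f) = a * v f.
Proof.
have /asboolP[vl _] := tangentP v.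
by rewrite -[_ *: f]addr0 vl tangent0 addr0.
Qed.

Lemma tangentN p (v : tangent p) f : v (- f) = - v f.
Proof. by rewrite -scaleN1r tangentZ mulN1r. Qed.

Lemma tangentB p (v : tangent p) f h : v (f - h) = v f - v h.
Proof. by rewrite tangentD tangentN. Qed.

Lemma tangent_sum p (v : tangent p) (I : Type) (r : seq I) (F : I -> smooth_fun M) :
  v (\sum_(i <- r) F i) = \sum_(i <- r) v (F i).
Proof. by apply: (big_morph _ (tangentD v) (tangent0 v)). Qed.

Lemma tangent1 p (v : tangent p) : v 1 = 0.
Proof.
have := tangentM v 1 1; rewrite mulr1 mul1r => /eqP.
by rewrite -subr_eq subrr eq_sym => /eqP.
Qed.

Definition csmooth (a : R) : smooth_fun M := a *: (1 : smooth_fun M).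

Lemma csmoothE a q : csmooth a q = a.
Proof. exact: mulr1. Qed.

Lemma tangent_cst p (v : tangent p) (a : R) : v (csmooth a) = 0.
Proof. by rewrite tangentZ tangent1 mulr0. Qed.

Lemma smooth_fun_eq f h : f =1 h -> f = h.
Proof. by move=> fh; apply/val_inj/funext. Qed.

Lemma sf0E q : (0 : smooth_fun M) q = 0. Proof. by []. Qed.
Lemma sf1E q : (1 : smooth_fun M) q = 1. Proof. by []. Qed.
Lemma sfDE f h q : (f + h) q = f q + h q. Proof. by []. Qed.
Lemma sfNE f q : (- f) q = - f q. Proof. by []. Qed.
Lemma sfBE f h q : (f - h) q = f q - h q. Proof. by []. Qed.
Lemma sfME f h q : (f * h) q = f q * h q. Proof. by []. Qed.
Lemma sfZE a f q : (a *: f) q = a * f q. Proof. by []. Qed.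
Definition sfE := (sf0E, sf1E, sfDE, sfNE, sfBE, sfME, sfZE).

Lemma tangent_eq p (v w : tangent p) : (forall f, v f = w f) -> v = w.
Proof. by move=> vw; apply/val_inj/funext. Qed.

Lemma tangent_addE p (v w : tangent p) f : (v + w) f = v f + w f.
Proof. by []. Qed.

Lemma tangent_scaleE p (v : tangent p) (a : R) f : (a *: v) f = a * v f.
Proof. by []. Qed.

Lemma tangent_sumE p (I : Type) (r : seq I) (F : I -> tangent p) f :
  (\sum_(i <- r) F i) f = \sum_(i <- r) F i f.
Proof. by apply: (big_morph (fun v : tangent p => v f)). Qed.

Lemma smooth_fun_sumE (I : Type) (r : seq I) (F : I -> smooth_fun M) q :
  (\sum_(i <- r) F i) q = \sum_(i <- r) F i q.
Proof. by apply: (big_morph (fun f : smooth_fun M => f q)). Qed.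

(** With a bump [b] at [p] supported where [f = h], the product [b * (f - h)] is the zero function,
    and the Leibniz rule at [p] isolates [v f - v h]. *)
Lemma tangent_local p (v : tangent p) f h : {near p, f =1 h} -> v f = v h.
Proof.
move=> fh; have [b [/nbhs_singleton b1 bU]] := bump_exists fh.
have : v (b * (f - h)) = 0.
  rewrite (_ : b * (f - h) = 0) ?tangent0 //; apply: smooth_fun_eq => q; rewrite !sfE.
  have [/nbhs_singleton /= ->|/nbhs_singleton ->] := bU q; first by rewrite subrr mulr0.
  by rewrite mul0r.
rewrite tangentM tangentB b1 mul1r sfBE (nbhs_singleton fh) subrr mul0r addr0.
by move/eqP; rewrite subr_eq0 => /eqP.
Qed.

Lemma coord_functions c p : atlas M c -> chart_dom c p ->
  exists X : 'I_n -> smooth_fun M, \forall q \near p, forall j, X j q = c q ord0 j.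
Proof.
move=> Mc cp.
have /fin_all_exists[X XE] (j : 'I_n) :
    exists F : smooth_fun M, {near p, F =1 (fun q => c q ord0 j)}.
  apply: smooth_extension.
  apply: (@msmooth_at_comp_chart _ _ _ c p (fun x => x ord0 j)) => //.
  by apply: smooth_onT_at; apply: smooth_on_coord; exact: openT.
by exists X; apply: near_forall.
Qed.

Lemma chart_smooth_at c q f : atlas M c -> chart_dom c q ->
  smooth_at (c q) (f \o chart_inv c).
Proof. by move=> Mc cq; exact: smooth_fun_at. Qed.

Lemma chart_diff c q f : atlas M c -> chart_dom c q ->
  differentiable (f \o chart_inv c) (c q).
Proof. by move=> Mc cq; exact: (nbhs_singleton (chart_smooth_at f Mc cq) [::]). Qed.

(* By Hadamard's lemma [f - f p] is near [p] a sum of products of functions, the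
   first factor of each being a centred coordinate, which vanishes at [p]. *)
Lemma tangent_coord c p (v : tangent p) (X : 'I_n -> smooth_fun M) f :
  atlas M c -> chart_dom c p ->
  (\forall q \near p, forall j, X j q = c q ord0 j) ->
  v f = \sum_j v (X j) * 'D_(delta_mx ord0 j) (f \o chart_inv c) (c p).
Proof.
move=> Mc cp XE.
have [r r0 rW] := nbhs_closed_ball (chart_img_near cp).
have [chi [schi chi1 chi0]] := euclidean_bump (c p) r0.
(* Hadamard's lemma is stated on all of R^n, so [f] read in the chart is cut off by [chi], which is
   1 near [c p]. *)
pose F : 'rV[R]_n -> R := chi * (f \o chart_inv c).
have sF : smooth_on setT F.
  apply: smooth_onT => x; have [xr|xr] := leP `|x - c p| r.
    apply: smooth_atM; first exact: smooth_onT_at.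
    by have [cx {1}<-] := rW x xr; exact: chart_smooth_at.
  apply: (@smooth_at_eq _ _ _ (cst 0)); last exact: smooth_at_cst.
  have : nbhs x (~` closed_ball_ Num.norm (c p) r).
    apply: open_nbhs_nbhs; split; first exact/closed_openC/closed_closed_ball_.
    by rewrite /closed_ball_ /= distrC; apply/negP; rewrite -ltNge.
  apply: filterS => y /= /negP; rewrite -ltNge distrC => /chi0 chiy.
  by rewrite /F fctE chiy mul0r.
have [h [sh hE FE]] := hadamard_lemma (c p) sF.
have nF : {near c p, F =1 f \o chart_inv c}.
  by apply: filterS chi1 => y y1; rewrite /F fctE y1 mul1r.
have Fp : F (c p) = f p by rewrite (nbhs_singleton nF) /= chart_inv_id.
have /fin_all_exists[H HE] (j : 'I_n) : exists H : smooth_fun M, {near p, H =1 h j \o c}.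
  apply: smooth_extension; apply: msmooth_at_comp_chart => //; exact: smooth_onT_at.
have fE : {near p, f =1 csmooth (f p) + \sum_j (X j - csmooth (X j p)) * H j}.
  have cF := near_chart cp nF; have cD := chart_dom_near cp.
  have XEp := nbhs_singleton XE; have nH := near_forall HE.
  near=> q.
  have cq : chart_dom c q by near: q.
  have Fq : F (c q) = (f \o chart_inv c) (c q) by near: q.
  have Hq : forall j, H j q = h j (c q) by near: q.
  have Xq : forall j, X j q = c q ord0 j by near: q.
  rewrite sfDE smooth_fun_sumE -[f q](congr1 f (chart_inv_id cq)) -[LHS]Fq FE Fp.
  rewrite csmoothE; congr (_ + _); apply: eq_bigr => j _.
  by rewrite sfME sfBE csmoothE Hq Xq XEp.
rewrite (tangent_local v fE) tangentD tangent_cst add0r tangent_sum.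
apply: eq_bigr => j _; rewrite tangentM tangentB tangent_cst subr0 sfBE.
rewrite csmoothE subrr mul0r add0r mulrC (nbhs_singleton (HE j)) /= hE.
by rewrite (near_eq_derive _ nF).
Unshelve. all: by end_near. Qed.

Lemma coord_derivation c p w : atlas M c -> chart_dom c p ->
  (fun f => 'D_w (f \o chart_inv c) (c p)) \in derivation p.
Proof.
move=> Mc cp; have df f := @diff_derivable _ _ _ _ _ w (chart_diff f Mc cp).
apply/asboolP; split=> [a f h|f h].
- rewrite (_ : _ \o _ = a *: (f \o chart_inv c) + (h \o chart_inv c)) //.
  by rewrite deriveD ?deriveZ //; exact: derivableZ.
- rewrite (_ : _ \o _ = (f \o chart_inv c) * (h \o chart_inv c)) //.
  by rewrite deriveM //= chart_inv_id.
Qed.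

Lemma smooth_coord_derive c p f w : atlas M c -> chart_dom c p ->
  msmooth_at p (fun q => 'D_w (f \o chart_inv c) (c q)).
Proof.
move=> Mc cp.
apply: (@msmooth_at_comp_chart _ _ _ c p (fun x => 'D_w (f \o chart_inv c) x)) => //.
have := chart_smooth_at f Mc cp.
by apply: filterS => x fx vs; exact: (fx (w :: vs)).
Qed.

Lemma coord_field c p w : atlas M c -> chart_dom c p ->
  exists Y : vector_field M, \forall q \near p, forall f,
    (Y q : tangent q) f = 'D_w (f \o chart_inv c) (c q).
Proof.
move=> Mc cp; have [b [b1 bU]] := bump_exists (chart_dom_near cp).
have Yd q : (fun f => b q * 'D_w (f \o chart_inv c) (c q)) \in derivation q.
  have [/nbhs_singleton cq|/nbhs_singleton b0] := bU q.
    exact: (rpredZ (b q) (coord_derivation w Mc cq)).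
  (* Here [q] may lie outside the chart, but [b] kills the formula and 0 is a derivation. *)
  rewrite b0 (_ : (fun f => _) = 0) ?rpred0 //; apply/funext => f.
  by rewrite mul0r.
have Ys : smooth_vector_field (fun q => Tangent (Yd q)).
  by move=> f; apply: (cutoff_smooth bU) => q cq; exact: smooth_coord_derive.
exists (@MkSection R n M (tangent_bundle M) _ Ys).
by apply: filterS b1 => q b1 f /=; rewrite b1 mul1r.
Qed.

End TangentVectors.

(** * Metrics, connections and orthonormal frames *)

Section SectionsMetricsConnections.
Context {R : realType} {n : nat} {M : manifold R n} {E : bundle M}.
Implicit Types (p q : M) (f h : smooth_fun M) (s t : section E).

Lemma secDE s t p : (s + t) p = s p + t p. Proof. by []. Qed.
Lemma secZE f s p : (f *: s) p = f p *: s p. Proof. by []. Qed.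
Lemma secNE s p : (- s) p = - s p.
Proof. by rewrite -[LHS]/(-1 *: s p) scaleN1r. Qed.
Lemma secBE s t p : (s - t) p = s p - t p.
Proof. by rewrite secDE secNE. Qed.
Lemma sec_sumE (I : Type) (r : seq I) (P : pred I) (F : I -> section E) p :
  (\sum_(i <- r | P i) F i) p = \sum_(i <- r | P i) F i p.
Proof. by apply: (big_morph (fun s : section E => s p)). Qed.

Variable g : fibre_metric E.

Lemma fmDl p (u v w : E p) : g p (u + v) w = g p u w + g p v w.
Proof. by rewrite -[u in LHS]scale1r fm_linear mul1r. Qed.
Lemma fm0l p (w : E p) : g p 0 w = 0.
Proof. by apply: (@addrI _ (g p 0 w)); rewrite -fmDl !addr0. Qed.
Lemma fmZl p a (u w : E p) : g p (a *: u) w = a * g p u w.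
Proof. by rewrite -[_ *: u]addr0 fm_linear fm0l addr0. Qed.
Lemma fmNl p (u w : E p) : g p (- u) w = - g p u w.
Proof. by rewrite -scaleN1r fmZl mulN1r. Qed.
Lemma fmBl p (u v w : E p) : g p (u - v) w = g p u w - g p v w.
Proof. by rewrite fmDl fmNl. Qed.
Lemma fm_suml p (I : Type) (r : seq I) (P : pred I) (F : I -> E p) w :
  g p (\sum_(i <- r | P i) F i) w = \sum_(i <- r | P i) g p (F i) w.
Proof. by apply: (big_morph (fun u => g p u w)) => [u v|]; rewrite ?fmDl ?fm0l. Qed.

Lemma fmDr p (w u v : E p) : g p w (u + v) = g p w u + g p w v.
Proof. by rewrite fm_sym fmDl !(fm_sym _ w). Qed.
Lemma fmZr p a (w u : E p) : g p w (a *: u) = a * g p w u.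
Proof. by rewrite fm_sym fmZl fm_sym. Qed.

Lemma fm_ge0 p (u : E p) : 0 <= g p u u.
Proof. by have [->|/(fm_pos g)/ltW//] := eqVneq u 0; rewrite fm0l. Qed.

Lemma fm_eq0 p (u : E p) : g p u u = 0 -> u = 0.
Proof.
by move=> u0; apply/eqP; apply: contraT => /(fm_pos g); rewrite u0 ltxx.
Qed.

Variable D : connection E.

Lemma connD p (v : tangent p) s t : D p v (s + t) = D p v s + D p v t.
Proof. exact: conn_add. Qed.
Lemma conn0 p (v : tangent p) : D p v 0 = 0.
Proof. by apply: (@addrI _ (D p v 0)); rewrite -connD !addr0. Qed.
Lemma connN p (v : tangent p) s : D p v (- s) = - D p v s.
Proof. by apply: (@addrI _ (D p v s)); rewrite -connD !subrr conn0. Qed.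
Lemma connB p (v : tangent p) s t : D p v (s - t) = D p v s - D p v t.
Proof. by rewrite connD connN. Qed.
Lemma conn_sum p (v : tangent p) (I : Type) (r : seq I) (P : pred I) (F : I -> section E) :
  D p v (\sum_(i <- r | P i) F i) = \sum_(i <- r | P i) D p v (F i).
Proof. exact: (big_morph _ (connD v) (conn0 v)). Qed.

Lemma connDl p (u v : tangent p) s : D p (u + v) s = D p u s + D p v s.
Proof. by rewrite -[u in LHS]scale1r conn_linear scale1r. Qed.
Lemma conn0l p s : D p 0 s = 0.
Proof. by apply: (@addrI _ (D p 0 s)); rewrite -connDl !addr0. Qed.
Lemma connZl p a (u : tangent p) s : D p (a *: u) s = a *: D p u s.
Proof. by rewrite -[_ *: u]addr0 conn_linear conn0l addr0. Qed.
Lemma conn_suml p (I : Type) (r : seq I) (P : pred I) (F : I -> tangent p) s :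
  D p (\sum_(i <- r | P i) F i) s = \sum_(i <- r | P i) D p (F i) s.
Proof. by apply: (big_morph (fun u => D p u s)) => [u v|]; rewrite ?connDl ?conn0l. Qed.

(** The cut-off argument of [tangent_local], with the Leibniz rule of the connection. *)
Lemma conn_local p (v : tangent p) s t : (\forall q \near p, s q = t q) ->
  D p v s = D p v t.
Proof.
move=> st; have [b [/nbhs_singleton b1 bU]] := bump_exists st.
have : D p v (b *: (s - t)) = 0.
  rewrite (_ : b *: (s - t) = 0) ?conn0 //; apply: section_eq => q.
  rewrite secZE secBE; have [/nbhs_singleton /= ->|/nbhs_singleton ->] := bU q.
    by rewrite subrr scaler0.
  by rewrite scale0r.
rewrite conn_leibniz secBE (nbhs_singleton st) subrr scaler0 add0r b1 scale1r.
by rewrite connB => /eqP; rewrite subr_eq0 => /eqP.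
Qed.

End SectionsMetricsConnections.

(** * Orthonormal frames *)

Section Frames.
Context {R : realType} {n : nat} {M : manifold R n}.
Variable g : fibre_metric (tangent_bundle M).
Implicit Types (p q : M) (f h : smooth_fun M).

Lemma smooth_at_rsqrt x (f : 'rV[R]_n -> R) : smooth_at x f -> 0 < f x ->
  smooth_at x (fun y => (Num.sqrt (f y))^-1).
Proof.
move=> /smooth_atE[U [oU Ux fU]] fx.
have cf : {for x, continuous f}.
  by apply: differentiable_continuous; exact: smooth_on_diff fU Ux.
have : \forall y \near x, U y /\ 0 < f y.
  apply: filterI; first exact: open_nbhs_nbhs.
  by apply: (cf [set t | 0 < t]); apply: open_nbhs_nbhs; split.
rewrite -nbhs_nearE nbhsE => -[W [oW Wx] WP].
apply/smooth_atE; exists W; split=> //; apply: smooth_on_rsqrt => //.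
  by apply: smooth_onS fU => y /WP[].
by move=> y /WP[].
Qed.

Lemma orthonormal_lin_indep (m : nat) q (e : 'I_m -> tangent q) (r : 'I_m -> R) :
  (forall i j, g q (e i) (e j) = (i == j)%:R) ->
  \sum_i r i *: e i = 0 -> forall i, r i = 0.
Proof.
move=> eo r0 i; have := congr1 (fun u => g q u (e i)) r0.
rewrite fm0l fm_suml (bigD1 i) //= big1 ?addr0 => [|j ji].
  by rewrite fmZl eo eqxx mulr1.
by rewrite fmZl eo (negbTE ji) mulr0.
Qed.

(** By [tangent_coord] a tangent vector is determined by its values on [n] coordinate functions. On
    these, [n] orthonormal vectors give a square matrix with independent rows, hence they span. The
    residue [w] is then a combination of the [e i] that is orthogonal to each of them, so it is
    0. *)
Lemma tangent_span q (e : 'I_n -> tangent q) (v : tangent q) :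
  (forall i j, g q (e i) (e j) = (i == j)%:R) ->
  v = \sum_i g q v (e i) *: e i.
Proof.
move=> eo; have [c Mc cq] := atlas_cover q.
have [X XE] := coord_functions Mc cq.
have coord0 (u : tangent q) : (forall j, u (X j) = 0) -> u = 0.
  move=> u0; apply: tangent_eq => f; rewrite (tangent_coord u f Mc cq XE).
  by rewrite big1 // => j _; rewrite u0 mul0r.
pose A := \matrix_(i < n, j < n) (e i (X j)).
have AE (r : 'rV[R]_n) j : (r *m A) ord0 j = (\sum_i r ord0 i *: e i) (X j).
  rewrite mxE tangent_sumE; apply: eq_bigr => i _.
  by rewrite mxE tangent_scaleE.
have fA : row_free A.
  rewrite -kermx_eq0; apply/rowV0P => r /sub_kermxP rA.
  have /(orthonormal_lin_indep eo) r0 : \sum_i r ord0 i *: e i = 0.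
    by apply: coord0 => j; rewrite -AE rA mxE.
  by apply/rowP => i; rewrite r0 mxE.
have uA : row_full A by rewrite row_full_unit -row_free_unit.
pose w := v - \sum_i g q v (e i) *: e i.
have we i : g q w (e i) = 0.
  rewrite fmBl fm_suml (bigD1 i) //= big1 ?addr0 => [|j ji].
    by rewrite fmZl eo eqxx mulr1 subrr.
  by rewrite fmZl eo (negbTE ji) mulr0.
have /submxP[r rE] : ((\row_j w (X j)) <= A)%MS by exact: submx_full.
have wE : w = \sum_i r ord0 i *: e i.
  apply/eqP; rewrite -subr_eq0; apply/eqP; apply: coord0 => j.
  transitivity ((w : tangent q) (X j) - (\sum_i r ord0 i *: e i : tangent q) (X j)).
    by [].
  by rewrite -AE -rE mxE subrr.
have w0 : w = 0.
  have r0 i : r ord0 i = 0.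
    have := we i; rewrite wE fm_suml (bigD1 i) //= big1 ?addr0 => [|j ji].
      by rewrite fmZl eo eqxx mulr1.
    by rewrite fmZl eo (negbTE ji) mulr0.
  by rewrite wE big1 // => i _; rewrite r0 scale0r.
by apply/eqP; rewrite -subr_eq0; apply/eqP.
Qed.

(** The fields are global but orthonormal only near [p]. Indexing them by [nat] keeps their type
    fixed while [k] grows. *)
Lemma gram_schmidt p (k : nat) : (k <= n)%N -> exists e : nat -> vector_field M,
  \forall q \near p, forall i j : 'I_k, g q (e i q) (e j q) = (i == j)%:R.
Proof.
elim: k => [_|k IH kn].
  by exists (fun=> 0); apply: nearW => q [].
have [e eo] := IH (ltnW kn).
have [c Mc cp] := atlas_cover p.
have [X XE] := coord_functions Mc cp.
have /fin_all_exists[Y YE] (l : 'I_n) := coord_field (delta_mx ord0 l) Mc cp.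
(* If at [p] every coordinate field were a combination of [k < n] vectors, the identity matrix of
   size [n] would have rank at most [k]. *)
have [l lP] : exists l, (Y l p : tangent p) <>
    \sum_(i < k) g p (Y l p) (e i p) *: (e i p : tangent p).
  apply: contrapT => /forallNP nex.
  have YeE l : (Y l p : tangent p) = \sum_(i < k) g p (Y l p) (e i p) *: (e i p : tangent p).
    by have /contrapT := nex l.
  pose A := \matrix_(i < k, j < n) ((e i p : tangent p) (X j)).
  pose B := \matrix_(l < n, i < k) g p (Y l p) (e i p).
  have BA : B *m A = 1%:M.
    apply/matrixP => l j; rewrite !mxE.
    transitivity ((Y l p : tangent p) (X j)).
      rewrite YeE tangent_sumE; apply: eq_bigr => i _.
      by rewrite !mxE tangent_scaleE.
    rewrite (nbhs_singleton (YE l)).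
    rewrite (@near_eq_derive _ _ _ _ (fun x : 'rV[R]_n => x ord0 j)).
      by rewrite derive_coord mxE eqxx eq_sym.
    have := near_chart_inv cp XE; have := chart_img_near cp.
    by apply: filterS2 => x [_ xE] XEx /=; rewrite XEx xE.
  have := mxrankM_maxl B A; rewrite BA mxrank1 => /leq_trans/(_ (rank_leq_col B)).
  by rewrite leqNgt kn.
pose W : vector_field M := Y l - \sum_(i < k) (fm_fun g (Y l) (e i) : smooth_fun M) *: e i.
have WE q : W q = Y l q - \sum_(i < k) g q (Y l q) (e i q) *: e i q.
  by rewrite secBE sec_sumE.
have W0 : W p != 0.
  by rewrite WE subr_eq0; apply/eqP.
pose h := fm_fun g W W.
have h0 : 0 < h p by exact: fm_pos.
(* The normalizing factor makes sense only where [W] is nonzero; a global function with the same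
   germ at [p] replaces it. *)
have [phi phiE] : exists phi : smooth_fun M, {near p, phi =1 fun q => (Num.sqrt (h q))^-1}.
  apply: smooth_extension; apply: (msmooth_at_chart Mc cp).
  apply: (@smooth_at_rsqrt _ (h \o chart_inv c)); first exact: chart_smooth_at.
  by rewrite /= chart_inv_id.
exists (fun i => if i == k then phi *: W else e i).
have hpos : \forall q \near p, 0 < h q.
  apply: (@smooth_fun_continuous _ _ _ h p [set t | 0 < t]).
  by apply: open_nbhs_nbhs; split.
move: eo phiE hpos; apply: filterS3 => q eo phiE hq.
have We (i : 'I_k) : g q (W q) (e i q) = 0.
  rewrite WE fmBl fm_suml (bigD1 i) //= big1 ?addr0 => [|j ji].
    by rewrite fmZl eo eqxx mulr1 subrr.
  by rewrite fmZl eo (negbTE ji) mulr0.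
have hn : phi q * (phi q * h q) = 1.
  rewrite phiE mulrA -invfM -expr2 sqr_sqrtr ?ltW // mulVf //.
  by rewrite gt_eqF.
have lt_k (i : 'I_k.+1) : (i : nat) != k -> (i < k)%N.
  by move=> ik; rewrite ltn_neqAle ik -ltnS ltn_ord.
move=> i j; have [ik|ik] := eqVneq (i : nat) k; have [jk|jk] := eqVneq (j : nat) k.
- rewrite !secZE fmZl fmZr hn (_ : i = j) ?eqxx //.
  by apply/val_inj; rewrite /= ik jk.
- rewrite secZE fmZl (We (Ordinal (lt_k j jk))) mulr0.
  by case: eqP => // ij; rewrite -ij ik eqxx in jk.
- rewrite secZE fmZr fm_sym (We (Ordinal (lt_k i ik))) mulr0.
  by case: eqP => // ij; rewrite ij jk eqxx in ik.
- by rewrite (eo (Ordinal (lt_k i ik)) (Ordinal (lt_k j jk))).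
Qed.

Lemma frame_atP p : \forall q \near p, forall i j,
  g q (@frame_at R n M g p i q) (@frame_at R n M g p j q) = (i == j)%:R.
Proof.
have [e eo] := @gram_schmidt p n (leqnn n).
apply: (@getPex _ (@orthonormal_frame_at R n M g p)).
by exists (fun i : 'I_n => e i).
Qed.

End Frames.

(** * Curvature and Laplacian *)

Section VectorBundleSections.
Context {R : realType} {n : nat} {M : manifold R n}.
Variable E : vector_bundle M.
Local Notation tvec t := (@triv_vec R n M E t).
Implicit Types (p q : M) (f : smooth_fun M) (s : section E).

Lemma triv_vec_smooth (t : local_triv (vb_fibre E)) (b : smooth_fun M) w :
  @vb_triv R n M E t ->
  (forall q, nbhs q (triv_dom t) \/ \forall q' \near q, b q' = 0) ->
  @smooth_vb_section R n M E (fun q => b q *: tvec t q w).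
Proof.
move=> Et bU u q Eu uq j.
have E1 : (fun q' => triv_coord u q' (b q' *: tvec t q' w) ord0 j) =
    (b : M -> R) * (fun q' => triv_coord u q' (tvec t q' w) ord0 j).
  by apply/funext => q'; rewrite linearZ mxE.
rewrite E1; have [/nbhs_singleton tq|b0] := bU q.
  by apply: msmooth_atM; [exact: smooth_fun_at|exact: vb_compat].
apply: (@msmooth_at_eq _ _ _ _ (cst 0)); last exact: msmooth_at_cst.
by apply: filterS b0 => q' b0; rewrite !fctE b0 mul0r.
Qed.

Lemma triv_vec_sum (t : local_triv (vb_fibre E)) q (w : 'rV[R]_(triv_rank t)) : triv_dom t q ->
  tvec t q w = \sum_i w ord0 i *: tvec t q (delta_mx ord0 i).
Proof.
move=> tq; apply: (can_inj (triv_coordK tq)); rewrite triv_vecK //.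
rewrite linear_sum {1}[w]row_sum_delta; apply: eq_bigr => i _.
by rewrite linearZ /= triv_vecK.
Qed.

(** The frame vectors of a trivialization, cut off to global sections. The clause for [s p = 0] is
    what makes the curvature tensorial. *)
Lemma local_frame_exists p : exists r (S : 'I_r -> section E),
  forall s : section E, exists F : 'I_r -> smooth_fun M,
    (\forall q \near p, s q = \sum_i F i q *: S i q) /\
    (s p = 0 -> forall i, F i p = 0).
Proof.
have [t Et tp] := @vb_cover R n M E p.
have tU : nbhs p (triv_dom t).
  by apply: open_nbhs_nbhs; split => //; exact: triv_dom_open.
have [b [b1 bU]] := bump_exists tU.
exists (triv_rank t),
  (fun i => @MkSection R n M E _ (triv_vec_smooth (delta_mx ord0 i) Et bU)).
move=> s.
have /fin_all_exists[F FE] (i : 'I_(triv_rank t)) :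
    exists F : smooth_fun M, {near p, F =1 (fun q => triv_coord t q (s q) ord0 i)}.
  by apply: smooth_extension; have := sectionP s; apply.
exists F; split.
  move: b1 tU (near_forall FE); apply: filterS3 => q b1 tq Fq /=.
  rewrite -[LHS](triv_coordK tq) triv_vec_sum //; apply: eq_bigr => i _.
  by rewrite b1 scale1r Fq.
by move=> s0 i; rewrite (nbhs_singleton (FE i)) s0 linear0 mxE.
Qed.

Variable D : connection E.

Lemma covd_scale (X : vector_field M) f s :
  covd D X (f *: s) = vf_apply X f *: s + f *: covd D X s.
Proof. by apply: section_eq => q; rewrite /= conn_leibniz. Qed.

Lemma covdD (X : vector_field M) (s t : section E) :
  covd D X (s + t) = covd D X s + covd D X t.
Proof. by apply: section_eq => q; rewrite /= connD. Qed.

Lemma curvatureD (X Y : vector_field M) (s t : section E) :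
  curvature D X Y (s + t) = curvature D X Y s + curvature D X Y t.
Proof.
rewrite /curvature !covdD !opprD !addrA.
by rewrite [LHS](ACl (1*3*5*2*4*6)%AC).
Qed.

(** The terms with one derivative on [f] and one on [s] cancel in pairs, and the second derivatives
    of [f] cancel against the bracket term. *)
Lemma curvature_scale (X Y : vector_field M) f s :
  curvature D X Y (f *: s) = f *: curvature D X Y s.
Proof.
rewrite /curvature !covd_scale !covdD !covd_scale.
apply: section_eq => q; rewrite !(secBE, secDE, secZE) !scalerBr.
have -> : vf_apply (bracket X Y) f q =
  vf_apply X (vf_apply Y f) q - vf_apply Y (vf_apply X f) q by [].
rewrite scalerBl !opprD !opprK !addrA.
rewrite [LHS](ACl (4*8*11*(1*9)*(2*7)*(3*6)*(5*10))%AC) /=.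
by rewrite !subrr addNr !addr0.
Qed.

Lemma curvature_local (X Y : vector_field M) p (s t : section E) :
  (\forall q \near p, s q = t q) ->
  curvature D X Y s p = curvature D X Y t p.
Proof.
move=> st; have stn := near_join st.
rewrite /curvature !secBE /=; congr (_ - _ - _).
- apply: (conn_local D (X p)); apply: filterS stn => q stq.
  exact: (conn_local D (Y q)).
- apply: (conn_local D (Y p)); apply: filterS stn => q stq.
  exact: (conn_local D (X q)).
- exact: (conn_local D (bracket X Y p)).
Qed.

(** [section_through] picks an arbitrary section with a given value at [p]; the curvature at [p]
    does not see this choice. Indeed a section vanishing at [p] is near [p] a combination of frame
    sections whose coefficients vanish at [p]. *)
Lemma curvature_tensorial (X Y : vector_field M) p (s t : section E) : s p = t p ->
  curvature D X Y s p = curvature D X Y t p.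
Proof.
move=> st; suff curv0 (w : section E) : w p = 0 -> curvature D X Y w p = 0.
  apply/eqP; rewrite -subr_eq0 -secBE; apply/eqP.
  have <- : curvature D X Y (s - t) = curvature D X Y s - curvature D X Y t.
    by rewrite -scaleN1r curvatureD curvature_scale scaleN1r.
  by apply: curv0; rewrite secBE st subrr.
have [r [S SE]] := local_frame_exists p.
have [F [FE F0]] := SE w; move=> /F0 Fp.
rewrite (@curvature_local _ _ _ _ (\sum_i F i *: S i)); last first.
  by apply: filterS FE => q ->; rewrite sec_sumE.
have c0 : curvature D X Y 0 = 0.
  by have := curvature_scale X Y 0 0; rewrite !scale0r.
rewrite (big_morph (curvature D X Y) (curvatureD X Y) c0).
rewrite sec_sumE big1 // => i _.
by rewrite curvature_scale secZE Fp scale0r.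
Qed.

End VectorBundleSections.

(** * Traces in orthonormal frames, Hessian and Laplacian *)

Section Traces.
Context {R : realType} {n : nat} {M : manifold R n}.
Variable g : fibre_metric (tangent_bundle M).
Implicit Types (p q : M) (f : smooth_fun M).

(** Expanding [e] in [e'] gives an orthogonal matrix of coefficients. The target [W] is a general
    module so that the lemma serves the real-valued Hessian as well as the Dirac operator, whose
    values lie in a fibre. *)
Lemma trace_frame_indep (W : lmodType R) q (B : tangent q -> tangent q -> W)
    (e e' : 'I_n -> tangent q) :
  (forall a u v w, B (a *: u + v) w = a *: B u w + B v w) ->
  (forall a u v w, B w (a *: u + v) = a *: B w u + B w v) ->
  (forall i j, g q (e i) (e j) = (i == j)%:R) ->
  (forall i j, g q (e' i) (e' j) = (i == j)%:R) ->
  \sum_i B (e i) (e i) = \sum_i B (e' i) (e' i).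
Proof.
move=> Bl Br eo eo'.
have B0l w : B 0 w = 0.
  by have := Bl (-1) 0 0 w; rewrite scaler0 addr0 scaleN1r addNr.
have B0r w : B w 0 = 0.
  by have := Br (-1) 0 0 w; rewrite scaler0 addr0 scaleN1r addNr.
have Bsuml (a : 'I_n -> R) (v : 'I_n -> tangent q) w :
    B (\sum_i a i *: v i) w = \sum_i a i *: B (v i) w.
  elim/big_rec2: _ => [|i y1 y2 _ <-]; first exact: B0l.
  exact: Bl.
have Bsumr (a : 'I_n -> R) (v : 'I_n -> tangent q) w :
    B w (\sum_i a i *: v i) = \sum_i a i *: B w (v i).
  elim/big_rec2: _ => [|i y1 y2 _ <-]; first exact: B0r.
  exact: Br.
transitivity (\sum_i \sum_j \sum_k
    (g q (e i) (e' j) * g q (e i) (e' k)) *: B (e' j) (e' k)).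
  apply: eq_bigr => i _; rewrite {1 2}(tangent_span (e i) eo') Bsuml.
  apply: eq_bigr => j _; rewrite Bsumr scaler_sumr; apply: eq_bigr => k _.
  by rewrite scalerA.
rewrite exchange_big; apply: eq_bigr => j _; rewrite exchange_big /=.
have jk k : \sum_i g q (e i) (e' j) * g q (e i) (e' k) = (j == k)%:R.
  rewrite -eo' {2}(tangent_span (e' j) eo) fm_suml; apply: eq_bigr => i _.
  by rewrite fmZl (@fm_sym _ _ _ _ g q (e' j)).
have sumS k : \sum_i (g q (e i) (e' j) * g q (e i) (e' k)) *: B (e' j) (e' k) =
    (j == k)%:R *: B (e' j) (e' k) by rewrite -jk scaler_suml.
under eq_bigr do rewrite sumS.
rewrite (bigD1 j) //= eqxx scale1r big1 ?addr0 // => k kj.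
by rewrite eq_sym (negbTE kj) scale0r.
Qed.

Lemma field_expand p (e : 'I_n -> vector_field M) (Y : vector_field M) :
  (\forall q \near p, forall i j, g q (e i q) (e j q) = (i == j)%:R) ->
  \forall q \near p, Y q = (\sum_i fm_fun g Y (e i) *: e i : vector_field M) q.
Proof.
apply: filterS => q eo; rewrite sec_sumE.
exact: (@tangent_span _ _ _ g q (fun i => e i q) (Y q) eo).
Qed.

Variable D : connection (tangent_bundle M).

(** The second covariant derivative of [f]. [Y] must be a field in order to be differentiated, but
    [hessZ] and [hess_local] make the value depend on [Y q] only. *)
Definition hess f q (u : tangent q) (Y : vector_field M) : R :=
  u (vf_apply Y f) - (D q u Y : tangent q) f.

Lemma hess_linearl f q a (u v : tangent q) Y :
  hess f (a *: u + v) Y = a * hess f u Y + hess f v Y.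
Proof.
rewrite /hess conn_linear tangent_addE tangent_scaleE.
have -> : (a *: D q u Y + D q v Y : tangent q) f =
  a * (D q u Y : tangent q) f + (D q v Y : tangent q) f by [].
by ring.
Qed.

Lemma hessD f q (u : tangent q) (X Y : vector_field M) :
  hess f u (X + Y) = hess f u X + hess f u Y.
Proof.
rewrite /hess connD.
have -> : vf_apply (X + Y) f = vf_apply X f + vf_apply Y f by exact: smooth_fun_eq.
have -> : (D q u X + D q u Y : tangent q) f =
  (D q u X : tangent q) f + (D q u Y : tangent q) f by [].
by rewrite tangentD; ring.
Qed.

Lemma hessZ f q (u : tangent q) (h : smooth_fun M) (Y : vector_field M) :
  hess f u (h *: Y) = h q * hess f u Y.
Proof.
rewrite /hess conn_leibniz.
have -> : vf_apply (h *: Y) f = h * vf_apply Y f by exact: smooth_fun_eq.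
have -> : (u h *: Y q + h q *: D q u Y : tangent q) f =
  u h * vf_apply Y f q + h q * (D q u Y : tangent q) f by [].
by rewrite tangentM; ring.
Qed.

Lemma hess_local f q (u : tangent q) (X Y : vector_field M) :
  (\forall q' \near q, X q' = Y q') -> hess f u X = hess f u Y.
Proof.
move=> XY; rewrite /hess (conn_local D u XY); congr (_ - _).
by apply: tangent_local; apply: filterS XY => q' /= ->.
Qed.

Lemma hess_sum f q (u : tangent q) (a : 'I_n -> smooth_fun M) (e : 'I_n -> vector_field M) :
  hess f u (\sum_i a i *: e i) = \sum_i a i q * hess f u (e i).
Proof.
have h0 : hess f u 0 = 0.
  by have := hessZ f u 0 0; rewrite scale0r mul0r.
rewrite (big_morph (hess f u) (hessD f u) h0).
by apply: eq_bigr => i _; exact: hessZ.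
Qed.

(** This is the Laplacian wherever [e] is orthonormal. Since the [e i] are global fields, the result
    is a global smooth function, whose continuity is used in [hopf_touching]. *)
Definition laplace (e : 'I_n -> vector_field M) f : smooth_fun M :=
  \sum_i (vf_apply (e i) (vf_apply (e i) f) - vf_apply (covd D (e i) (e i)) f).

Lemma laplaceE (e : 'I_n -> vector_field M) f q :
  laplace e f q = \sum_i hess f (e i q : tangent q) (e i).
Proof. by rewrite smooth_fun_sumE. Qed.

(** It links [laplace_norm_sqr], valid at the centre of [frame_at p], to the maximum principle,
    which keeps one frame on a neighbourhood. *)
Lemma laplace_frame_indep (e e' : 'I_n -> vector_field M) f q :
  (\forall q' \near q, forall i j, g q' (e i q') (e j q') = (i == j)%:R) ->
  (\forall q' \near q, forall i j, g q' (e' i q') (e' j q') = (i == j)%:R) ->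
  laplace e f q = laplace e' f q.
Proof.
move=> eo eo'; rewrite !laplaceE.
(* The Hessian as a bilinear form on tangent vectors: the second argument is expanded in [e'], whose
   members are fields. *)
pose B (u v : tangent q) : R := \sum_j g q v (e' j q) * hess f u (e' j).
have BE (Y : vector_field M) (u : tangent q) : hess f u Y = B u (Y q).
  by rewrite (hess_local f u (field_expand Y eo')) hess_sum.
under eq_bigr do rewrite BE; under [RHS]eq_bigr do rewrite BE.
apply: (@trace_frame_indep R^o q B (fun i => e i q) (fun i => e' i q)).
- move=> a u v w; rewrite /B scaler_sumr -big_split; apply: eq_bigr => j _.
  by rewrite hess_linearl /GRing.scale /=; ring.
- move=> a u v w; rewrite /B scaler_sumr -big_split; apply: eq_bigr => j _.
  by rewrite fm_linear /GRing.scale /=; ring.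
- exact: nbhs_singleton eo.
- exact: nbhs_singleton eo'.
Qed.

Lemma laplaceD e f h q : laplace e (f + h) q = laplace e f q + laplace e h q.
Proof.
rewrite !laplaceE -big_split; apply: eq_bigr => i _; rewrite /= /hess.
have -> : vf_apply (e i) (f + h) = vf_apply (e i) f + vf_apply (e i) h.
  by apply: smooth_fun_eq => q'; exact: tangentD.
by rewrite !tangentD; ring.
Qed.

Lemma laplaceZ e (a : R) f q : laplace e (a *: f) q = a * laplace e f q.
Proof.
rewrite !laplaceE mulr_sumr; apply: eq_bigr => i _; rewrite /hess.
have -> : vf_apply (e i) (a *: f) = a *: vf_apply (e i) f.
  by apply: smooth_fun_eq => q'; exact: tangentZ.
by rewrite !tangentZ; ring.
Qed.

Lemma laplace_csmooth e (a : R) q : laplace e (csmooth a) q = 0.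
Proof.
rewrite laplaceE big1 // => i _; rewrite /hess tangent_cst subr0.
rewrite (_ : vf_apply (e i) (csmooth a) = 0) ?tangent0 //.
by apply: smooth_fun_eq => q'; exact: tangent_cst.
Qed.

Lemma laplaceM e f h q : laplace e (f * h) q = f q * laplace e h q +
  h q * laplace e f q + 2 * \sum_i (e i q : tangent q) f * (e i q : tangent q) h.
Proof.
rewrite !laplaceE !mulr_sumr -!big_split; apply: eq_bigr => i _; rewrite /= /hess.
have -> : vf_apply (e i) (f * h) = f * vf_apply (e i) h + h * vf_apply (e i) f.
  by apply: smooth_fun_eq => q'; exact: tangentM.
rewrite tangentD !tangentM /=; ring.
Qed.

End Traces.

(** * The Weitzenboeck identity *)

Section Weitzenboeck.
Context {R : realType} {n : nat} {M : manifold R n}.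
Variable g : fibre_metric (tangent_bundle M).
Variable LC : connection (tangent_bundle M).
Hypothesis hLC : levi_civita g LC.
Variable C : clifford_family g.
Variable DC : connection (clifford_bundle C).
Hypothesis hDC : induced_connection LC DC.
Variable S : dirac_bundle DC.
Implicit Types (p q : M) (s : section S).

Lemma cmul0l p (x : S p) : cmul (0 : C p) x = 0.
Proof.
by have := cmul_linearl (-1) (0 : C p) 0 x; rewrite scaler0 addr0 scaleN1r addNr.
Qed.

Lemma cmul0r p (a : C p) : cmul a (0 : S p) = 0.
Proof.
by have := cmul_linearr (-1) a (0 : S p) 0; rewrite scaler0 addr0 scaleN1r addNr.
Qed.

Lemma vmul_linearl p a (u v : tangent p) (x : S p) :
  vmul (a *: u + v) x = a *: vmul u x + vmul v x.
Proof. by rewrite /vmul linearP cmul_linearl. Qed.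

Lemma vmul_linearr p a (u : tangent p) (x y : S p) :
  vmul u (a *: x + y) = a *: vmul u x + vmul u y.
Proof. exact: cmul_linearr. Qed.

Lemma vmul0l p (x : S p) : vmul (0 : tangent p) x = 0.
Proof. by rewrite /vmul linear0 cmul0l. Qed.

Lemma vmul0r p (u : tangent p) : vmul u (0 : S p) = 0.
Proof. exact: cmul0r. Qed.

Lemma vmulDl p (u v : tangent p) (x : S p) : vmul (u + v) x = vmul u x + vmul v x.
Proof. by rewrite -[u in LHS]scale1r vmul_linearl scale1r. Qed.

Lemma vmulZl p a (u : tangent p) (x : S p) : vmul (a *: u) x = a *: vmul u x.
Proof. by rewrite -[_ *: u]addr0 vmul_linearl vmul0l addr0. Qed.

Lemma vmulDr p (u : tangent p) (x y : S p) : vmul u (x + y) = vmul u x + vmul u y.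
Proof. by rewrite -[x in LHS]scale1r vmul_linearr scale1r. Qed.

Lemma vmulZr p a (u : tangent p) (x : S p) : vmul u (a *: x) = a *: vmul u x.
Proof. by rewrite -[_ *: x]addr0 vmul_linearr vmul0r addr0. Qed.

Lemma vmulNr p (u : tangent p) (x : S p) : vmul u (- x) = - vmul u x.
Proof. by rewrite -scaleN1r vmulZr scaleN1r. Qed.

Lemma vmulBr p (u : tangent p) (x y : S p) : vmul u (x - y) = vmul u x - vmul u y.
Proof. by rewrite vmulDr vmulNr. Qed.

Lemma vmul_suml p (I : Type) (r : seq I) (F : I -> tangent p) (x : S p) :
  vmul (\sum_(i <- r) F i) x = \sum_(i <- r) vmul (F i) x.
Proof.
by apply: (big_morph (fun u => vmul u x)) => [u v|]; rewrite ?vmulDl ?vmul0l.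
Qed.

Lemma vmul_sumr p (I : Type) (r : seq I) (F : I -> S p) (u : tangent p) :
  vmul u (\sum_(i <- r) F i) = \sum_(i <- r) vmul u (F i).
Proof.
by apply: (big_morph (vmul u)) => [x y|]; rewrite ?vmulDr ?vmul0r.
Qed.

Lemma vmul_sqr p (u : tangent p) (x : S p) : vmul u (vmul u x) = - (g p u u *: x).
Proof.
rewrite /vmul -cmulA (cl_clifford C p).1.
rewrite -scaleNr -[_ *: (1 : C p)]addr0 cmul_linearl cmul0l cmul1 addr0.
by rewrite scaleNr.
Qed.

(** Polarization of [vmul_sqr]. *)
Lemma vmul_anticomm p (u v : tangent p) (x : S p) : g p u v = 0 ->
  vmul u (vmul v x) = - vmul v (vmul u x).
Proof.
move=> uv; have := vmul_sqr (u + v) x.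
rewrite !vmulDl !vmulDr !vmul_sqr fmDl !fmDr uv (fm_sym g v u) uv.
rewrite addr0 add0r scalerDl opprD => E; apply/eqP; rewrite -addr_eq0; apply/eqP.
apply: (@addrI _ (- (g p u u *: x))); apply: (@addIr _ (- (g p v v *: x))).
by rewrite addr0 -E -!addrA; congr (_ + _); rewrite addrC -!addrA.
Qed.

(** [dirac_op] uses a different frame at each [q]; this allows the equation [D s = 0] to be written
    near [p] in one frame and differentiated there. *)
Lemma dirac_op_frame s q (e : 'I_n -> tangent q) :
  (forall i j, g q (e i) (e j) = (i == j)%:R) ->
  dirac_op s q = \sum_i vmul (e i) (db_conn S q (e i) s).
Proof.
move=> eo; rewrite /dirac_op.
apply: (@trace_frame_indep _ _ _ g (S q) q
  (fun u w : tangent q => vmul u (db_conn S q w s))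
  (fun i => @frame_at R n M g q i q) e) => //.
- by move=> a u v w; exact: vmul_linearl.
- by move=> a u v w; rewrite conn_linear vmul_linearr.
- exact: nbhs_singleton (frame_atP g q).
Qed.

Section AtPoint.
Variables (p : M) (s : section S).
Hypothesis Ds : forall q, dirac_op s q = 0.
Let e := @frame_at R n M g p.
Let N := db_conn S.

Let eo : forall i j, g p (e i p) (e j p) = (i == j)%:R.
Proof. exact: nbhs_singleton (frame_atP g p). Qed.

(** The invariant second derivative of [s] at [p] in the directions [e i], [e j]; the correction
    term replaces the customary choice of a frame parallel at [p]. *)
Definition second_derivative (i j : 'I_n) : S p :=
  N p (e i p) (covd N (e j) s) - N p (LC p (e i p) (e j)) s.

(** The products [g (e j) (e k)] are constant near [p] and the connection is metric. *)
Lemma frame_connection_skew (i j k : 'I_n) :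
  g p (LC p (e i p) (e j)) (e k p) = - g p (LC p (e i p) (e k)) (e j p).
Proof.
have [mLC _] := hLC; have := mLC p (e i p) (e j) (e k).
rewrite (@tangent_local _ _ _ _ _ _ (csmooth ((j == k)%:R : R))).
  rewrite tangent_cst => /esym/eqP; rewrite addr_eq0 => /eqP ->.
  by rewrite fm_sym.
by apply: filterS (frame_atP g p) => q qo; rewrite csmoothE /= qo.
Qed.

(* Differentiate the Dirac equation along [e i]; the terms where the derivative
   falls on the frame turn, as the connection coefficients are skew, into the
   first-order terms of the second derivatives. *)
Lemma clifford_trace_second_derivative i :
  \sum_j vmul (e j p) (second_derivative i j) = 0.
Proof.
pose A j : section S := MkSection (cmul_smooth (cl_vf C (e j)) (covd N (e j) s)).
have A0 : \forall q \near p, (\sum_j A j) q = (0 : section S) q.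
  apply: filterS (frame_atP g p) => q qo.
  transitivity (dirac_op s q); last exact: Ds.
  by rewrite sec_sumE (@dirac_op_frame s q (fun i => e i q)).
have := conn_local N (e i p) A0; rewrite conn0 conn_sum => sA.
transitivity (\sum_j N p (e i p) (A j)); last exact: sA.
have AE j : N p (e i p) (A j) = vmul (LC p (e i p) (e j)) (N p (e j p) s) +
    vmul (e j p) (N p (e i p) (covd N (e j) s)).
  by rewrite /N cmul_leibniz hDC.1.
rewrite (eq_bigr _ (fun j _ => AE j)) big_split /=.
rewrite /second_derivative; under eq_bigr do rewrite vmulBr.
rewrite sumrB addrC; congr (_ + _).
pose w j k := g p (LC p (e i p) (e j)) (e k p).
have LCE j : (LC p (e i p) (e j) : tangent p) = \sum_k w j k *: (e k p : tangent p).
  exact: (@tangent_span _ _ _ g p (fun k => e k p) (LC p (e i p) (e j)) eo).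
transitivity (- \sum_j \sum_k w j k *: vmul (e j p) (N p (e k p) s)).
  congr (- _); apply: eq_bigr => j _; rewrite LCE conn_suml vmul_sumr.
  by apply: eq_bigr => k _; rewrite connZl vmulZr.
transitivity (\sum_j \sum_k w j k *: vmul (e k p) (N p (e j p) s)); last first.
  apply: eq_bigr => j _; rewrite LCE vmul_suml.
  by apply: eq_bigr => k _; rewrite vmulZl.
rewrite exchange_big /= -sumrN; apply: eq_bigr => k _.
rewrite -sumrN; apply: eq_bigr => j _.
by rewrite -scaleNr -frame_connection_skew.
Qed.

(** Torsion-freeness identifies the difference of the two correction terms with the bracket term of
    the curvature. *)
Lemma second_derivative_curvature i j :
  second_derivative i j - second_derivative j i = curvature N (e i) (e j) s p.
Proof.
have [_ tf] := hLC; have tfp := congr1 (fun X => section_val X p) (tf (e i) (e j)).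
rewrite /second_derivative /curvature !secBE /=.
rewrite [X in _ = _ - X](_ : _ = N p (LC p (e i p) (e j)) s - N p (LC p (e j p) (e i)) s).
  rewrite !opprD !opprK !addrA.
  by rewrite [LHS](ACl (1*3*2*4)%AC).
rewrite -[X in N p X s]/(bracket (e i) (e j) p) -tfp.
rewrite secBE /=.
by rewrite connDl -scaleN1r connZl scaleN1r.
Qed.

(** In the double sum [E0] the diagonal is minus the trace, since [e_i] squares to [-1]. Off the
    diagonal, anticommutation merges the terms [(i, j)] and [(j, i)] into [e_i e_j] applied to a
    difference of second derivatives, which is the curvature. *)
Lemma bochner_identity : \sum_i second_derivative i i = weitzenbock (s p).
Proof.
have E0 : \sum_i \sum_j vmul (e i p) (vmul (e j p) (second_derivative i j)) = 0.
  rewrite big1 // => i _.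
  by rewrite -vmul_sumr clifford_trace_second_derivative vmul0r.
have sE : section_through (s p) p = s p.
  have : [set t : section S | t p = s p] (section_through (s p)).
    by apply: getPex; exists s.
  by [].
have wE : weitzenbock (s p) = \sum_(i < n) \sum_(j < n | (i < j)%N)
    vmul (e i p) (vmul (e j p) (second_derivative i j - second_derivative j i)).
  apply: eq_bigr => i _; apply: eq_bigr => j _.
  by rewrite second_derivative_curvature (curvature_tensorial N (e i) (e j) sE).
pose F i j := vmul (e i p) (vmul (e j p) (second_derivative i j)).
have FE i j : i != j -> vmul (e i p) (vmul (e j p) (second_derivative j i)) = - F j i.
  by move=> ij; rewrite vmul_anticomm // eo (negbTE ij).
rewrite {}wE; have -> : \sum_(i < n) \sum_(j < n | (i < j)%N)
    vmul (e i p) (vmul (e j p) (second_derivative i j - second_derivative j i)) =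
    \sum_(i < n) \sum_(j < n | (i < j)%N) (F i j + F j i).
  apply: eq_bigr => i _; apply: eq_bigr => j ij.
  rewrite (vmulBr _ (second_derivative i j)) vmulBr FE ?opprK //.
  by rewrite neq_ltn ij.
have diag i : F i i = - second_derivative i i.
  by rewrite /F vmul_sqr eo eqxx scale1r.
under [RHS]eq_bigr do rewrite big_split; rewrite [RHS]big_split /=.
rewrite [X in _ = _ + X](exchange_big_dep xpredT) //=.
have split_sum : \sum_(i < n) \sum_(j < n) F i j =
    \sum_(i < n) (F i i + \sum_(j < n | (i < j)%N) F i j + \sum_(j < n | (j < i)%N) F i j).
  apply: eq_bigr => i _; rewrite (bigD1 i) //= -addrA; congr (_ + _).
  rewrite (bigID (fun j : 'I_n => (i < j)%N)) /=; congr (_ + _); apply: eq_bigl => j.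
    case: (ltngtP i j) => ij; rewrite ?andbT ?andbF // -(inj_eq val_inj) /=.
    by rewrite gtn_eqF.
  by rewrite -(inj_eq val_inj) /=; case: ltngtP.
rewrite split_sum !big_split /= (eq_bigr _ (fun i _ => diag i)) sumrN -addrA in E0.
apply/esym/eqP; rewrite -subr_eq0 addrC.
by apply/eqP; exact: E0.
Qed.

Lemma laplace_norm_sqr : laplace LC e (fm_fun (db_metric S) s s) p =
  2 * (db_metric S p (weitzenbock (s p)) (s p) +
       \sum_i db_metric S p (N p (e i p) s) (N p (e i p) s)).
Proof.
rewrite laplaceE -bochner_identity fm_suml -big_split mulr_sumr /=.
apply: eq_bigr => i _; rewrite /hess.
have VE : vf_apply (e i) (fm_fun (db_metric S) s s) =
    2%:R *: fm_fun (db_metric S) (covd N (e i) s) s.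
  apply: smooth_fun_eq => q; rewrite sfZE /=.
  rewrite (db_conn_metric (e i q) s s) (fm_sym (db_metric S) (s q)).
  by rewrite mulrDl !mul1r.
rewrite VE tangentZ !db_conn_metric /= /second_derivative fmBl.
rewrite (fm_sym (db_metric S) (s p)); ring.
Qed.

End AtPoint.
End Weitzenboeck.

(** * The strong maximum principle *)

Section LocalMaxima.
Context {R : realType} {n : nat}.
Implicit Types (f : 'rV[R]_n -> R) (x a : 'rV[R]_n).

Lemma near_line x a (P : 'rV[R]_n -> Prop) : (\forall y \near x, P y) ->
  exists2 d : R, 0 < d & forall t, `|t| < d -> P (x + t *: a).
Proof.
move=> /nbhs_normP[r /= r0 rP]; exists (r / (`|a| + 1)).
  by rewrite divr_gt0 // ltr_wpDl.
move=> t td; apply: rP; rewrite /ball_ /= opprD addrA subrr sub0r normrN normrZ.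
have a1 : 0 < `|a| + 1 by rewrite ltr_wpDl.
apply: (@le_lt_trans _ _ (`|t| * (`|a| + 1))); first by rewrite ler_wpM2l // lerDl.
by rewrite -ltr_pdivlMr.
Qed.

Lemma derive_local_max x f a : smooth_at x f -> (\forall y \near x, f y <= f x) ->
  'D_a f x = 0.
Proof.
move=> /(near_line a)[d d0 sf] /(near_line a)[d' d'0 mf].
pose h (t : R) := f (x + t *: a); pose e := Num.min d d'.
have e0 : 0 < e by rewrite lt_min d0.
have dh (t : R) : `|t| < e -> is_derive t 1 h ('D_a f (x + t *: a)).
  by rewrite lt_min => /andP[td _]; apply: is_derive_line; exact: (sf t td [::]).
have : is_derive (0 : R) 1 h 0.
  apply: (@derive1_at_max _ h (- e) e 0).
  - by rewrite (@le_trans _ _ 0) ?oppr_le0 ?ltW.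
  - move=> t; rewrite in_itv /= -ltr_norml => te; exact: (@ex_derive _ _ _ _ _ _ _ (dh t te)).
  - by rewrite in_itv /= oppr_lt0 e0.
  - move=> t; rewrite in_itv /= -ltr_norml lt_min => /andP[_ td'].
    by rewrite /h scale0r addr0; exact: mf.
move=> h0; have h1 := dh 0 _; rewrite normr0 in h1.
have := @derive_val _ _ _ _ _ _ _ (h1 e0).
by rewrite scale0r addr0 => <-; exact: derive_val.
Qed.

(** The derivative [phi] of [f] along the line vanishes at 0. Were the second derivative positive,
    [phi] would be positive for small [t > 0], and by the mean value theorem [f] would exceed its
    maximum. *)
Lemma derive2_local_max x f a : smooth_at x f -> (\forall y \near x, f y <= f x) ->
  'D_a (fun y => 'D_a f y) x <= 0.
Proof.
move=> sx mx; have D0 := derive_local_max a sx mx.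
have [d d0 sf] := near_line a sx; have [d' d'0 mf] := near_line a mx.
rewrite leNgt; apply/negP => L0.
pose phi (t : R) := 'D_a f (x + t *: a).
have dphi : is_derive (0 : R) 1 phi ('D_a (fun y => 'D_a f y) x).
  have := @is_derive_line _ _ (fun y => 'D_a f y) x a 0.
  rewrite scale0r addr0; apply.
  by have := sf 0 _ [:: a]; rewrite scale0r addr0 normr0; apply.
have : \forall h \near (0 : R)^', 0 < h^-1 *: (phi h - phi 0).
  have cv : (fun h : R => h^-1 *: ((phi \o shift 0) (h *: 1) - phi 0)) @ 0^' -->
      'D_a (fun y => 'D_a f y) x.
    have [cv <-] := dphi; exact: cv.
  near=> h.
  have -> : phi h = (phi \o shift 0) (h *: 1) by rewrite /= addr0 [h *: 1]mulr1.
  near: h; exact: (cvgr_gt _ cv _ L0).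
rewrite near_withinE => /nbhs_normP[r /= r0 rP].
pose e := Num.min (Num.min d d') r.
have e0 : 0 < e by rewrite !lt_min d0 d'0.
have e20 : 0 < e / 2 by rewrite divr_gt0.
have e2e : e / 2 < e by rewrite ltr_pdivrMr // ltr_pMr // ltr1n.
have le_e t : 0 <= t -> t <= e / 2 -> [/\ `|t| < d, `|t| < d' & `|t| < r].
  move=> t0 te; have : `|t| < e by rewrite ger0_norm // (le_lt_trans te).
  by rewrite !lt_min => /andP[/andP[]].
have dh (t : R) : `|t| < d -> is_derive t 1 (fun t : R => f (x + t *: a)) (phi t).
  by move=> td; apply: is_derive_line; exact: (sf t td [::]).
have [t||c] := @MVT _ (fun t : R => f (x + t *: a)) phi 0 (e / 2) e20.
- rewrite in_itv /= => /andP[t0 te]; have [td _ _] := le_e t (ltW t0) (ltW te).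
  exact: dh.
- apply: derivable_within_continuous => t; rewrite in_itv /= => /andP[t0 te].
  have [td _ _] := le_e t t0 te; exact: (@ex_derive _ _ _ _ _ _ _ (dh t td)).
rewrite in_itv /= => /andP[c0 ce] E.
have [_ _ cr] := le_e c (ltW c0) (ltW ce).
have [_ ed' _] := le_e (e / 2) (ltW e20) (lexx _).
have := mf _ ed'; rewrite -subr_le0; move: E; rewrite scale0r addr0 => ->.
apply/negP; rewrite -ltNge subr0 pmulr_lgt0 //.
have : 0 < c^-1 *: (phi c - phi 0).
  by apply: rP => /=; [rewrite sub0r normrN|rewrite gt_eqF].
have -> : phi 0 = 0 by rewrite /phi scale0r addr0.
rewrite subr0 -[_ *: _]/(_ * _) pmulr_rgt0 //.
by rewrite invr_gt0.
Unshelve. all: by end_near. Qed.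

End LocalMaxima.

(** * Sign of the Laplacian at a local maximum *)

Section LaplaceLocalMaximum.
Context {R : realType} {n : nat} {M : manifold R n}.
Implicit Types (f : smooth_fun M) (y : M).

Lemma tangent_local_max f y (v : tangent y) :
  (\forall q \near y, f q <= f y) -> v f = 0.
Proof.
move=> fy; have [c Mc cy] := atlas_cover y.
have [X XE] := coord_functions Mc cy.
rewrite (tangent_coord v f Mc cy XE) big1 // => j _.
rewrite derive_local_max ?mulr0 //; first exact: chart_smooth_at.
by have := near_chart_inv cy fy; apply: filterS => x; rewrite /= chart_inv_id.
Qed.

(** In coordinates [X (X f)] is a second directional derivative plus first derivatives of [f]
    weighted by derivatives of the components of [X]; the latter terms vanish at a critical
    point. *)
Lemma vf_apply2_local_max f y (X : vector_field M) :
  (\forall q \near y, f q <= f y) -> (X y : tangent y) (vf_apply X f) <= 0.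
Proof.
move=> fy; have [c Mc cy] := atlas_cover y.
have [x xE] := coord_functions Mc cy.
pose F := f \o chart_inv c; pose del j := (delta_mx ord0 j : 'rV[R]_n).
have sF : smooth_at (c y) F by exact: chart_smooth_at.
have mF : \forall z \near c y, F z <= F (c y).
  by have := near_chart_inv cy fy; apply: filterS => z; rewrite /F /= chart_inv_id.
have /fin_all_exists[d dE] (j : 'I_n) : exists d : smooth_fun M,
    {near y, d =1 fun q => 'D_(del j) F (c q)}.
  by apply: smooth_extension; exact: smooth_coord_derive.
have XfE : {near y, vf_apply X f =1 \sum_j vf_apply X (x j) * d j}.
  have xE' := near_join xE; have cy' := chart_dom_near cy.
  move: xE' cy' (near_forall dE); apply: filterS3 => q xq cq dq.
  rewrite smooth_fun_sumE [LHS](tangent_coord (X q : tangent q) f Mc cq xq).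
  by apply: eq_bigr => j _; rewrite sfME dq.
rewrite (tangent_local _ XfE) tangent_sum.
(* The components of [X] frozen at [y]. *)
pose a : 'rV[R]_n := \row_j (X y : tangent y) (x j).
have d0 j : d j y = 0.
  by rewrite (nbhs_singleton (dE j)); exact: derive_local_max.
suff -> : \sum_j (X y : tangent y) (vf_apply X (x j) * d j) =
    'D_a (fun z => 'D_a F z) (c y) by exact: derive2_local_max.
rewrite (@near_eq_derive _ _ _ _
  (\sum_j (cst (a ord0 j) * (fun z => 'D_(del j) F z)))); last first.
  apply: filterS sF => z /(_ [::]) dz; rewrite derive_delta // fct_sumE.
  by apply: eq_bigr => j _; rewrite fctE.
have dd j : differentiable (fun z => 'D_(del j) F z) (c y).
  exact: (nbhs_singleton sF [:: del j]).
rewrite derive_sum; last first.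
  by move=> j; apply: diff_derivable; apply: differentiableM => //; exact: dd.
apply: eq_bigr => j _; rewrite deriveM //; [|exact/diff_derivable/dd].
rewrite derive_cst scaler0 addr0 tangentM d0 mul0r addr0.
rewrite [a ord0 j]mxE /GRing.scale /=; congr (_ * _).
rewrite (derive_delta _ (dd j)) (tangent_coord _ (d j) Mc cy xE).
apply: eq_bigr => i _; rewrite [a ord0 i]mxE; congr (_ * _).
apply: near_eq_derive; have := near_chart_inv cy (dE j); have := chart_img_near cy.
by apply: filterS2 => z [_ zE] /= ->; rewrite zE.
Qed.

Lemma laplace_local_max (D : connection (tangent_bundle M)) (e : 'I_n -> vector_field M) f y :
  (\forall q \near y, f q <= f y) -> laplace D e f y <= 0.
Proof.
move=> fy; rewrite laplaceE; apply: sumr_le0 => i _.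
by rewrite /hess (tangent_local_max (D y _ _) fy) subr0; exact: vf_apply2_local_max.
Qed.

End LaplaceLocalMaximum.

(** * Hopf's barrier argument *)

Section MaximumPrinciple.
Context {R : realType} {n : nat} {M : manifold R n}.
Variable D : connection (tangent_bundle M).
Implicit Types (f u rho : smooth_fun M) (p q : M).

Lemma smooth_fun_near_gt f p (a : R) : a < f p -> \forall q \near p, a < f q.
Proof.
move=> afp; apply: (@smooth_fun_continuous _ _ _ f p [set t | a < t]).
by apply: open_nbhs_nbhs; split.
Qed.

Lemma smooth_fun_near_lt f p (a : R) : f p < a -> \forall q \near p, f q < a.
Proof.
move=> afp; apply: (@smooth_fun_continuous _ _ _ f p [set t | t < a]).
by apply: open_nbhs_nbhs; split.
Qed.

Lemma closed_smooth_le f (a : R) : closed [set q | f q <= a].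
Proof.
apply: (@closed_comp _ _ f [set t | t <= a]) => [q _|]; last exact: closed_le.
exact: smooth_fun_continuous.
Qed.

Lemma closed_smooth_ge f (a : R) : closed [set q | a <= f q].
Proof.
apply: (@closed_comp _ _ f [set t | a <= t]) => [q _|]; last exact: closed_ge.
exact: smooth_fun_continuous.
Qed.

Lemma compact_smooth_max f (K : set M) : compact K -> K !=set0 ->
  exists2 y, K y & forall q, K q -> f q <= f y.
Proof.
move=> cK K0; have [y /[!inE] Ky ymax] : exists2 c, c \in K & forall t, t \in K -> f t <= f c.
  apply: compact_EVT_max => //.
  by apply: continuous_subspaceT; exact: smooth_fun_continuous.
by exists y => // q Kq; apply: ymax; rewrite inE.
Qed.

(** [sigma] marks the boundary: a maximum point over [K] either has [sigma >= r], away from [p], or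
    is a local maximum on the manifold. Near [p], [sigma] is the squared distance in a chart. *)
Lemma compact_neighbourhood p (W : set M) : nbhs p W ->
  exists K (sigma : smooth_fun M) (r : R),
  0 < r /\ [/\ compact K, K `<=` W, K p,
   forall q, K q -> sigma q < r -> nbhs q K & sigma p = 0].
Proof.
move=> pW; have [c Mc cp] := atlas_cover p.
have [sg sgE] : exists sigma : smooth_fun M, {near p, sigma =1 sqdist (c p) \o c}.
  apply: smooth_extension; apply: msmooth_at_comp_chart => //.
  by apply: smooth_onT_at; exact: smooth_sqdist.
pose P q := [/\ W q, sg q = sqdist (c p) (c q) & chart_dom c q].
have pP : \forall q \near p, P q.
  by move: pW sgE (chart_dom_near cp); apply: filterS3.
have pP2 : \forall q \near p, \forall q' \near q, P q' by exact: near_join.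
have := near_chart_inv cp pP2 => /filterI /(_ (chart_img_near cp))/nbhs_closed_ball[r r0 rU].
pose B := chart_inv c @` [set x : 'rV[R]_n | `|x - c p| <= r].
have cB : compact B by apply: compact_chart_ball => x /rU[].
pose K := B `&` [set q | sg q <= r ^+ 2].
have sgp : sg p = 0 by rewrite (nbhs_singleton sgE) /= sqdistxx.
exists K, sg, (r ^+ 2); split; last split => //.
- by rewrite exprn_gt0.
- by apply: compact_closedI => //; exact: closed_smooth_le.
- by move=> q [[x /rU[/nbhs_singleton[Wx _ _] _] <-] _].
- split; last by rewrite /= sgp sqr_ge0.
  by exists (c p); rewrite ?chart_inv_id //= subrr normr0 ltW.
- move=> q [[x /rU[xP _] <-] _] /smooth_fun_near_lt sq.
  move: xP sq; apply: filterS2 => q' [_ sgq' cq'] sq'.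
  split; last exact: ltW.
  exists (c q'); last exact: chart_inv_id.
  by apply: norm_le_sqdist; [exact: ltW|rewrite -sgq' ltW].
Qed.

(* The barrier is the polynomial [(rho x0 + eta - rho)^2 - eta^2]: near [x0] it
   is positive exactly where [rho < rho x0], and its Laplacian at [x0] is
   [2 |d rho|^2 - 2 eta (laplace rho)], positive for [eta] small. *)
Lemma hopf_touching (e : 'I_n -> vector_field M) u rho x0 :
  (\forall q \near x0, u q <= u x0) ->
  (\forall q \near x0, 0 <= laplace D e u q) ->
  (\forall q \near x0, rho q <= rho x0 -> q <> x0 -> u q < u x0) ->
  \sum_i ((e i x0 : tangent x0) rho) ^+ 2 = 0.
Proof.
move=> umax Lu rho_u; set G := \sum_i _.
have G0 : 0 <= G by apply: sumr_ge0 => i _; exact: sqr_ge0.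
apply/eqP; apply: contraT => Gn0; have {G0 Gn0} G0 : 0 < G by rewrite lt_neqAle eq_sym Gn0.
(* With this [eta] one has [eta * L < G], so the Laplacian [2 G - 2 eta L] of the barrier at [x0] is
   positive. *)
exfalso; pose L := laplace D e rho x0; pose eta := G / (`|L| + 1).
have L1 : 0 < `|L| + 1 by rewrite ltr_wpDl.
have eta0 : 0 < eta by rewrite divr_gt0.
have etaL : eta * L < G.
  apply: (@le_lt_trans _ _ (eta * `|L|)); first by rewrite ler_pM2l // ler_norm.
  by rewrite /eta mulrAC ltr_pdivrMr // ltr_pM2l // ltrDl.
pose h : smooth_fun M := csmooth (rho x0 + eta) - rho.
have hE q : h q = rho x0 + eta - rho q by rewrite sfBE csmoothE.
pose v : smooth_fun M := h * h - csmooth (eta ^+ 2).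
have vE q : v q = h q ^+ 2 - eta ^+ 2 by rewrite sfBE csmoothE sfME expr2.
have hx0 : h x0 = eta by rewrite hE addrAC subrr add0r.
have lapN f q : laplace D e (- f) q = - laplace D e f q.
  by rewrite -scaleN1r laplaceZ mulN1r.
have Lv : 0 < laplace D e v x0.
  have Lh : laplace D e h x0 = - L by rewrite laplaceD laplace_csmooth lapN add0r.
  have eh i : (e i x0 : tangent x0) h = - (e i x0 : tangent x0) rho.
    by rewrite tangentB tangent_cst sub0r.
  rewrite laplaceD lapN laplace_csmooth oppr0 addr0 laplaceM Lh hx0.
  have -> : \sum_i (e i x0 : tangent x0) h * (e i x0 : tangent x0) h = G.
    by apply: eq_bigr => i _; rewrite eh mulrNN expr2.
  lra.
have near_eta : \forall q \near x0, 0 < h q < 2 * eta.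
  have h1 : \forall q \near x0, 0 < h q by apply: smooth_fun_near_gt; rewrite hx0.
  have h2 : \forall q \near x0, h q < 2 * eta.
    by apply: smooth_fun_near_lt; rewrite hx0; lra.
  by near=> q; apply/andP; split; near: q.
have nW : \forall q \near x0, [/\ u q <= u x0, 0 <= laplace D e u q,
    rho q <= rho x0 -> q <> x0 -> u q < u x0, 0 < laplace D e v q & 0 < h q < 2 * eta].
  have Lvn := smooth_fun_near_gt Lv.
  by near=> q; split; near: q.
have [K [sg [r [r0 [cK KW Kx0 Kint sgx0]]]]] := compact_neighbourhood nW.
(* The outer part of [K] where the barrier is not negative. There [u < u x0], with a uniform gap by
   compactness, which leaves room for a small multiple of [v]. *)
pose Z := (K `&` [set q | r <= sg q]) `&` [set q | rho q <= rho x0].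
have cZ : compact Z.
  apply: compact_closedI; last exact: closed_smooth_le.
  by apply: compact_closedI => //; exact: closed_smooth_ge.
have [eps eps0 epsP] : exists2 eps : R, 0 < eps & forall q, Z q -> u q + eps * v q < u x0.
  have [Z0|Z0] := pselect (Z !=set0); last first.
    by exists 1 => // q Zq; exfalso; apply: Z0; exists q.
  have [z Zz zmax] := compact_smooth_max u cZ Z0.
  have uz : u z < u x0.
    have [[Kz rz] rhoz] := Zz; have [_ _ zP _ _] := KW _ Kz; apply: zP => // zx0.
    by move: rz; rewrite /= zx0 sgx0 leNgt r0.
  (* A crude positive upper bound for [v] on [K], where [0 < h < 2 eta]. *)
  pose b := 4 * eta ^+ 2 + 1; have b0 : 0 < b by rewrite ltr_wpDl // mulr_ge0 // sqr_ge0.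
  exists ((u x0 - u z) / b); first by rewrite divr_gt0 // subr_gt0.
  move=> q Zq; have [[Kq _] _] := Zq; have [_ _ _ _ /andP[hq0 hq]] := KW _ Kq.
  have vb : v q < b.
    rewrite vE /b; have : h q ^+ 2 <= (2 * eta) ^+ 2 by rewrite ler_sqr ?nnegrE; lra.
    have := sqr_ge0 eta; lra.
  have := zmax q Zq; rewrite mulrAC; have : (u x0 - u z) * v q / b < u x0 - u z.
    by rewrite ltr_pdivrMr // ltr_pM2l // subr_gt0.
  lra.
pose f : smooth_fun M := u + eps *: v.
have fE q : f q = u q + eps * v q by [].
have [y Ky ymax] := compact_smooth_max f cK (ex_intro _ x0 Kx0).
have fx0 : f x0 = u x0 by rewrite fE vE hx0 subrr mulr0 addr0.
have fy : u x0 <= f y by rewrite -fx0; exact: ymax.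
have [uy Luy _ Lvy /andP[hy0 hy]] := KW _ Ky.
(* A maximum point [y] of [f = u + eps v] on [K] is impossible everywhere: on [Z] by the choice of
   [eps], on the rest of the outer part because [v < 0] there, and inside because the Laplacian of
   [f] is positive on [K]. *)
have [sy|sy] := leP r (sg y).
  have [ry|ry] := leP (rho y) (rho x0).
    by have := epsP y (conj (conj Ky sy) ry); rewrite -fE ltNge fy.
  have hye : h y < eta by rewrite hE; lra.
  have vy : v y < 0.
    by rewrite vE subr_lt0 ltr_sqr ?nnegrE ?ltW.
  have : f y < u y by rewrite fE gtrDl pmulr_rlt0.
  by rewrite ltNge (le_trans uy fy).
have : laplace D e f y <= 0.
  by apply: laplace_local_max; apply: filterS (Kint y Ky sy) => q; exact: ymax.
rewrite laplaceD laplaceZ => h1.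
have := mulr_gt0 eps0 Lvy; lra.
Unshelve. all: by end_near. Qed.

End MaximumPrinciple.

(** * Strong maximum principle and constancy on components *)

Section StrongMaximum.
Context {R : realType} {n : nat} {M : manifold R n}.
Variable g : fibre_metric (tangent_bundle M).
Variable D : connection (tangent_bundle M).
Implicit Types (f u rho : smooth_fun M) (p q : M).

(* [hopf_touching] is applied at a point [x0] of [{u = u p}] closest to a point
   [x1] with [u x1 < u p]; adding the squared distance to [x0] makes [x0] the
   only point of [{u = u p}] in the closed ball touching that set. *)
Lemma strong_maximum u p :
  (forall x, \forall q \near x, 0 <= laplace D (@frame_at R n M g x) u q) ->
  (\forall q \near p, u q <= u p) -> \forall q \near p, u q = u p.
Proof.
move=> Lu umax; have [c Mc cp] := atlas_cover p.
have := near_chart_inv cp (near_join umax).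
move/filterI => /(_ _ (chart_img_near cp))/nbhs_closed_ball[r r0 rU].
pose B := chart_inv c @` [set x : 'rV[R]_n | `|x - c p| <= r].
have cB : compact B by apply: compact_chart_ball => x /rU[].
(* Since [x0] is no farther from [x1] than [p] is, [sqdist_triangle] bounds its squared distance to
   [p] by [2 (s + s) = r^2 / 4], so [x0] lies inside [B]. *)
pose s := (r / 2) ^+ 2 / 4.
have r20 : 0 < r / 2 by rewrite divr_gt0.
have s0 : 0 < s by rewrite divr_gt0 // exprn_gt0.
have near_s : \forall q \near p, chart_dom c q /\ sqdist (c p) (c q) < s.
  apply: filterI; first exact: chart_dom_near.
  exact: near_chart cp (sqdist_near (c p) s0).
have Bp : B p by exists (c p); rewrite ?chart_inv_id //= subrr normr0 ltW.
have BE q : chart_dom c q -> sqdist (c p) (c q) <= r ^+ 2 -> B q.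
  move=> cq qr; exists (c q); last exact: chart_inv_id.
  by apply: norm_le_sqdist => //; exact: ltW.
move: umax near_s (chart_dom_near cp); apply: filterS3 => x1 ux1 [cx1 x1s] _.
apply/eqP; rewrite eq_le ux1 /= leNgt; apply/negP => {ux1} ux1.
pose K := B `&` [set q | u p <= u q].
have cK : compact K by apply: compact_closedI => //; exact: closed_smooth_ge.
have Bc q : B q -> chart_dom c q by move=> [x /rU[_ [cx _]] <-].
have [x0 /[!inE] Kx0 x0min] : exists2 z, z \in K &
    forall q, q \in K -> sqdist (c x1) (c z) <= sqdist (c x1) (c q).
  apply: (@compact_EVT_min _ _ (fun q => sqdist (c x1) (c q))) => //.
    by exists p; split => //=.
  apply: continuous_in_subspaceT => q /[!inE] -[/Bc cq _].
  apply: msmooth_at_continuous; apply: (msmooth_at_comp_chart (F := sqdist (c x1)) Mc cq).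
  by apply: smooth_onT_at; exact: smooth_sqdist.
have [Bx0 /= ux0] := Kx0; have cx0 := Bc _ Bx0.
have x0s : sqdist (c x1) (c x0) < s.
  have pK : p \in K by rewrite inE; split => //=.
  by apply: le_lt_trans (x0min p pK) _; rewrite sqdistC.
have x0r : sqdist (c p) (c x0) < r ^+ 2.
  apply: le_lt_trans (sqdist_triangle _ (c x1) _) _.
  have : 2 * (s + s) <= r ^+ 2 by rewrite /s; have := sqr_ge0 r; lra.
  apply: lt_le_trans; lra.
have umaxB q : B q -> u q <= u p by move=> [x /rU[/nbhs_singleton ? _] <-].
have ux0E : u x0 = u p by apply/eqP; rewrite eq_le ux0 umaxB.
have nB : \forall q \near x0, B q.
  have near_r : \forall x \near c x0, sqdist (c p) x < r ^+ 2.
    have cs : {for c x0, continuous (sqdist (c p))}.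
      apply: differentiable_continuous; exact: smooth_on_diff (smooth_sqdist _) _.
    by apply: (cs [set t | t < r ^+ 2]); apply: open_nbhs_nbhs; split.
  move: (near_chart cx0 near_r) (chart_dom_near cx0).
  by apply: filterS2 => q qr cq; apply: BE => //; exact: ltW.
pose F : 'rV[R]_n -> R := sqdist (c x1) + sqdist (c x0).
have sF : smooth_on setT F.
  by apply: smooth_onD; [exact: openT|exact: smooth_sqdist|exact: smooth_sqdist].
have [rho rhoE] : exists rho : smooth_fun M, {near x0, rho =1 F \o c}.
  by apply: smooth_extension; apply: msmooth_at_comp_chart => //; exact: smooth_onT_at.
have rhox0 : rho x0 = sqdist (c x1) (c x0).
  by rewrite (nbhs_singleton rhoE) /= /F fctE sqdistxx addr0.
have e_rho : \sum_i ((@frame_at R n M g x0 i x0 : tangent x0) rho) ^+ 2 = 0.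
  apply: (@hopf_touching _ _ _ D _ u).
  - by rewrite ux0E; apply: filterS nB => q /umaxB.
  - exact: Lu.
  - move: nB rhoE (chart_dom_near cx0); apply: filterS3 => q Bq rq cq qr qx0.
    rewrite ux0E lt_neqAle umaxB // andbT; apply/eqP => uq.
    have Kq : q \in K by rewrite inE; split => //=; rewrite uq.
    move: qr; rewrite rq rhox0 /= /F fctE => qr.
    have q0 : sqdist (c x0) (c q) = 0.
      apply/eqP; rewrite eq_le sqdist_ge0 andbT.
      by have := x0min q Kq; lra.
    by apply: qx0; rewrite -(chart_inv_id cq) (sqdist_eq0 q0) chart_inv_id.
have {}e_rho i : (@frame_at R n M g x0 i x0 : tangent x0) rho = 0.
  apply/eqP; rewrite -sqrf_eq0; apply/eqP.
  exact: (psumr_eq0P (fun i _ => sqr_ge0 _) e_rho).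
have v_rho (v : tangent x0) : v rho = 0.
  rewrite (@tangent_span _ _ _ g x0 (fun i => @frame_at R n M g x0 i x0) v); last first.
    exact: nbhs_singleton (frame_atP g x0).
  rewrite tangent_sumE big1 // => i _.
  by rewrite tangent_scaleE e_rho mulr0.
(* Along the radial direction from [x1] to [x0], [rho] has derivative twice the squared distance of
   these points, the summand centred at [x0] being critical there. Its vanishing forces
   [x0 = x1]. *)
have := v_rho (Tangent (coord_derivation (c x0 - c x1) Mc cx0)) => /=.
rewrite (@near_eq_derive _ _ _ _ F); last first.
  have := near_chart_inv cx0 rhoE; have := chart_img_near cx0.
  by apply: filterS2 => z [_ zE] /= ->; rewrite zE.
have ds x : differentiable (sqdist x) (c x0).
  exact: smooth_on_diff (smooth_sqdist x) _.
rewrite deriveD; [|exact: diff_derivable..].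
rewrite !derive_sqdist [X in _ + 2 * X]big1 => [|j _]; last by rewrite subrr mul0r.
rewrite mulr0 addr0 => /eqP; rewrite mulf_eq0 pnatr_eq0 /= => /eqP d0.
have : c x0 = c x1.
  apply: sqdist_eq0; rewrite -d0; apply: eq_bigr => j _.
  by rewrite !mxE expr2.
move/(congr1 (chart_inv c)); rewrite !chart_inv_id // => x01.
by move: ux1; rewrite -x01 ux0E ltxx.
Qed.

(** A ball in a chart is the union of the segments from its centre. Together with [component_open]
    this makes a local maximum within a component one on the manifold. *)
Lemma chart_connected_nbhs p : exists U : set M,
  [/\ nbhs p U, U p & connected U].
Proof.
have [c Mc cp] := atlas_cover p.
have := chart_img_near cp => /nbhs_closed_ball[r r0 rU].
pose B := [set x : 'rV[R]_n | `|x - c p| <= r].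
pose seg x := (fun t : R => chart_inv c (c p + t *: (x - c p))) @` `[0, 1].
have segB x (t : R) : B x -> t \in `[0, 1] -> B (c p + t *: (x - c p)).
  rewrite /B /= in_itv /= => xB /andP[t0 t1].
  rewrite addrC addKr normrZ ger0_norm // (le_trans _ xB) //.
  by rewrite ler_piMl.
exists (\bigcup_(x in B) seg x); split.
- have : \forall q \near p, B (c q).
    apply: (@near_chart _ _ _ c p B cp); apply/nbhs_normP; exists r => // x /=.
    by rewrite /B /ball_ /= distrC => /ltW.
  move/filterI => /(_ _ (chart_dom_near cp)); apply: filterS => q [Bq cq].
  exists (c q) => //; exists 1; first by rewrite /= in_itv /= ler01 lexx.
  by rewrite scale1r subrKC chart_inv_id.
- exists (c p); first by rewrite /B /= subrr normr0 ltW.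
  exists 0; first by rewrite /= in_itv /= ler01 lexx.
  by rewrite scale0r addr0 chart_inv_id.
- apply: bigcup_connected.
    exists p => x _; exists 0; first by rewrite /= in_itv /= ler01 lexx.
    by rewrite scale0r addr0 chart_inv_id.
  move=> x Bx; apply: connected_continuous_connected; first exact: segment_connected.
  apply: continuous_in_subspaceT => t /[!inE] /= tI.
  have [ct E] := rU _ (segB x t Bx tI).
  apply: (@continuous_comp _ _ _ (fun t : R => c p + t *: (x - c p)) (chart_inv c));
    last by rewrite -E; exact: chart_inv_cvg.
  apply: differentiable_continuous.
  by apply: differentiableD => //; apply: differentiableZl.
Qed.

Lemma component_open p : open (connected_component [set: M] p).
Proof.
rewrite openE => q pq; have [U [qU Uq cU]] := chart_connected_nbhs q.
apply: filterS qU => z Uz; apply: connected_component_trans pq _.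
exact: (connected_component_max Uq _ cU).
Qed.

(** On the compact component [u] attains its maximum; the set where it does is closed by continuity
    and open by the strong maximum principle, which is the second hypothesis. *)
Lemma constant_on_components u p : compact [set: M] ->
  (forall q, (\forall z \near q, u z <= u q) -> \forall z \near q, u z = u q) ->
  forall q, connected_component [set: M] p q -> u q = u p.
Proof.
move=> cM sm; pose C := connected_component [set: M] p.
have oC : open C by exact: component_open.
have clC : closed C by apply: component_closed; exact: closedT.
have Cp : C p by exact: connected_component_refl.
have cC : compact C by rewrite -(setTI C); exact: compact_closedI.
have [y Cy ymax] := compact_smooth_max u cC (ex_intro _ p Cp).
have lmax z : C z -> u z = u y -> \forall q \near z, u q = u y.
  move=> Cz uz; rewrite -uz; apply: sm.
  have : nbhs z C by exact: open_nbhs_nbhs.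
  by apply: filterS => q Cq; rewrite uz; exact: ymax.
have CE : C `&` [set q | u q = u y] = C.
  apply: (component_connected (A := [set: M]) (x := p)).
  - by exists y; split.
  - exists ([set q | u q = u y]°); first exact: open_interior.
    apply/seteqP; split=> [q [Cq uq]|q [Cq /nbhs_singleton uq]]; split => //.
    exact: lmax.
  - exists ([set q | u q <= u y] `&` [set q | u y <= u q]).
      by apply: closedI; [exact: closed_smooth_le|exact: closed_smooth_ge].
    apply/seteqP; split=> [q [Cq /= uq]|q [Cq [/= uq uq']]]; split => //=.
      by rewrite uq; split.
    by apply/eqP; rewrite eq_le uq.
have uy q : C q -> u q = u y by rewrite -CE => -[].
by move=> q Cq; rewrite (uy q Cq) (uy p Cp).
Qed.

(** Both [u] and [-u] have a local maximum at [p]. *)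
Lemma laplace_near_constant (e : 'I_n -> vector_field M) u p :
  (\forall q \near p, u q = u p) -> laplace D e u p = 0.
Proof.
move=> uc; apply/eqP; rewrite eq_le laplace_local_max /=; last first.
  by apply: filterS uc => q ->.
rewrite -oppr_le0 -mulN1r -laplaceZ; apply: laplace_local_max.
by apply: filterS uc => q uq; rewrite !sfZE uq.
Qed.

End StrongMaximum.

(** * The vanishing theorem *)

Theorem theoremA (R : realType) (n : nat) (M : manifold R n)
    (g : fibre_metric (tangent_bundle M))
    (LC : connection (tangent_bundle M)) (hLC : levi_civita g LC)
    (C : clifford_family g)
    (DC : connection (clifford_bundle C)) (hDC : induced_connection LC DC)
    (S : dirac_bundle DC)
    (hM : compact [set: M])
    (hpsd : forall p : M, weitzenbock_psd_at S p) :
  (forall s : section S, (forall p : M, dirac_op s p = 0) ->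
     parallel s /\
     (forall p : M, db_metric S p (weitzenbock (s p)) (s p) = 0)) /\
  (connected [set: M] -> (exists p : M, weitzenbock_pd_at S p) ->
   forall s : section S, (forall p : M, dirac_op s p = 0) -> s = 0).
Proof.
pose norm2 (s : section S) := fm_fun (db_metric S) s s.
pose e p := @frame_at R n M g p.
have sumN_ge0 (s : section S) p : 0 <= \sum_(i < n) db_metric S p
    (db_conn S p (e p i p) s) (db_conn S p (e p i p) s).
  by apply: sumr_ge0 => i _; exact: fm_ge0.
have const s : (forall p, dirac_op s p = 0) ->
    forall p q, connected_component [set: M] p q -> norm2 s q = norm2 s p.
  move=> Ds p; apply: constant_on_components => // q; apply: (@strong_maximum _ _ _ g LC).
  (* The frame chosen at [x] is still orthonormal around each nearby [z], so the Laplacian at [z]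
     can be recomputed in the frame of [z], where the Bochner formula applies. *)
  move=> x; move: (near_join (frame_atP g x)); apply: filterS => z xz.
  rewrite (laplace_frame_indep _ _ xz (frame_atP g z)) (laplace_norm_sqr hLC hDC _ Ds).
  by apply: mulr_ge0 => //; apply: addr_ge0; [exact: hpsd|exact: sumN_ge0].
have main s : (forall p, dirac_op s p = 0) -> parallel s /\
     (forall p : M, db_metric S p (weitzenbock (s p)) (s p) = 0).
  move=> Ds.
  have zero p : db_metric S p (weitzenbock (s p)) (s p) + \sum_(i < n) db_metric S p
      (db_conn S p (e p i p) s) (db_conn S p (e p i p) s) = 0.
    have uc : \forall q \near p, norm2 s q = norm2 s p.
      have : nbhs p (connected_component [set: M] p).
        apply: open_nbhs_nbhs; split; first exact: component_open.
        exact: connected_component_refl.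
      by apply: filterS => q; exact: const.
    have := laplace_near_constant LC (e p) uc.
    rewrite (laplace_norm_sqr hLC hDC _ Ds) => /eqP.
    by rewrite mulf_eq0 pnatr_eq0 /= => /eqP.
  have both p : db_metric S p (weitzenbock (s p)) (s p) = 0 /\ \sum_(i < n) db_metric S p
      (db_conn S p (e p i p) s) (db_conn S p (e p i p) s) = 0.
    move/eqP: (zero p); rewrite paddr_eq0; [|exact: hpsd|exact: sumN_ge0].
    by move=> /andP[/eqP ? /eqP ?].
  split=> [p X|p]; last by have [] := both p.
  have [_ sum0] := both p.
  have e0 i : db_conn S p (e p i p) s = 0.
    apply: (@fm_eq0 _ _ _ _ (db_metric S)).
    exact: (psumr_eq0P (fun i _ => fm_ge0 (db_metric S) _) sum0).
  rewrite (@tangent_span _ _ _ g p (fun i => e p i p) X); last first.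
    exact: nbhs_singleton (frame_atP g p).
  by rewrite conn_suml big1 // => i _; rewrite connZl e0 scaler0.
split=> // cM [p pd] s Ds; have [_ Rs] := main s Ds.
have sp : s p = 0.
  by apply/eqP; apply: contraT => /pd; rewrite Rs ltxx.
apply: section_eq => q; apply: (@fm_eq0 _ _ _ _ (db_metric S)).
(* On a connected manifold the component of [p] is everything, so the zero of [s] at [p] spreads to
   all [q]. *)
have : norm2 s q = norm2 s p by apply: const => //; rewrite connected_component_id.
by rewrite /= => ->; rewrite sp fm0l.
Qed.
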